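(* Let $\boldsymbol\beta=(\{X_g\}_{g\in\Gamma},\{\beta_g\}_{g\in\Gamma})$ be a partial action of an exact discrete group $\Gamma$ on a locally compact space $X$. Then the partial transformation groupoid $\Gamma\ltimes_\beta X$ is strongly amenable at infinity.
   Context: Conventions. Locally compact spaces are Hausdorff and second countable; discrete groups are countable. A discrete group $\Gamma$ is exact if it has an amenable action on a compact space (equivalently, $C^*_r(\Gamma)$ is an exact $C^*$-algebra). A partial action of $\Gamma$ on $X$ is a family of open subsets $X_g\subset X$ and homeomorphisms $\beta_g:X_{g^{-1}}\to X_g$ ($g\in\Gamma$) with $X_e=X$, $\beta_e=\mathrm{Id}_X$, and $\beta_{gh}$ extending $\beta_g\circ\beta_h$ for all $g,h$. $\Gamma\ltimes_\beta X=\{(g,x)\in\Gamma\times X:x\in X_{g^{-1}}\}$, with the topology induced by $\Gamma\times X$, is the (étale, locally compact) groupoid with unit space $X$, $r(g,x)=\beta_g(x)$, $s(g,x)=x$, $(g,\beta_h(x))(h,x)=(gh,x)$, $(g,x)^{-1}=(g^{-1},\beta_g(x))$. For a locally compact groupoid $\mathcal G$ with range and source maps $r,s:\mathcal G\to\mathcal G^{(0)}$, a left $\mathcal G$-space $(Y,p)$ is a locally compact space $Y$ with a continuous map $p:Y\to\mathcal G^{(0)}$ and a continuous map $(\gamma,y)\mapsto\gamma y$ from $\{(\gamma,y):s(\gamma)=p(y)\}$ to $Y$ with $p(\gamma y)=r(\gamma)$, $p(y)y=y$, $(\gamma_2\gamma_1)y=\gamma_2(\gamma_1y)$. $Y\rtimes\mathcal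 G=\{(y,\gamma):p(y)=r(\gamma)\}$ is the groupoid with unit space $Y$, $r(y,\gamma)=y$, $s(y,\gamma)=\gamma^{-1}y$, $(y,\gamma)(\gamma^{-1}y,\gamma_1)=(y,\gamma\gamma_1)$. A locally compact groupoid $\mathcal G$ is amenable if there is a net $(m_i)$, $m_i=(m_i^x)_{x\in\mathcal G^{(0)}}$ with $m_i^x$ a probability measure on $r^{-1}(x)$, such that $x\mapsto\int f\,dm_i^x$ is continuous for every $f\in C_c(\mathcal G)$ and $\lim_i\|\gamma m_i^{s(\gamma)}-m_i^{r(\gamma)}\|_1=0$ uniformly on compact subsets of $\mathcal G$. $\mathcal G$ is strongly amenable at infinity if there is a left $\mathcal G$-space $(Y,p)$ with $p$ proper, surjective and admitting a continuous section $\mathcal G^{(0)}\to Y$, such that $Y\rtimes\mathcal G$ is amenable. (An action of a discrete group on a compact space is amenable if the corresponding transformation groupoid is amenable.) *)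

(* Defs.v *)
From HB Require Import structures.
From mathcomp Require Import all_boot all_order all_algebra.
From mathcomp Require Import all_classical all_reals all_analysis.
Set Implicit Arguments.
Unset Strict Implicit.
Unset Printing Implicit Defensive.
Import Order.TTheory GRing.Theory Num.Theory.
Import numFieldNormedType.Exports.
Local Open Scope classical_set_scope.
Local Open Scope ring_scope.

Definition lc_space (X : topologicalType) : Prop :=
  [/\ hausdorff_space X, locally_compact [set: X] & @second_countable X].

Lemma set_val_continuous (U : topologicalType) (A : set U) :
  continuous (set_val : set_type A -> U).
Proof. exact: initial_continuous. Qed.

Lemma set_type_continuous (T U : topologicalType) (A : set U)
    (f : T -> set_type A) :
  continuous (fun t => set_val (f t)) -> continuous f.
Proof.
move=> /continuousP cf; apply/continuousP => _ [V oV <-].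
exact: cf.
Qed.

Lemma pair_continuous (T U V : topologicalType) (f : T -> U) (g : T -> V) :
  continuous f -> continuous g -> continuous (fun t => (f t, g t)).
Proof. by move=> cf cg t; apply: cvg_pair; [exact: cf|exact: cg]. Qed.

Lemma comp_continuous (S T U : topologicalType) (f : S -> T) (g : T -> U) :
  continuous f -> continuous g -> continuous (fun s => g (f s)).
Proof. by move=> cf cg s; apply: continuous_comp; [exact: cf|exact: cg]. Qed.

Lemma fst_continuous (T U : topologicalType) : continuous (@fst T U).
Proof. by move=> x; exact: cvg_fst. Qed.

Lemma snd_continuous (T U : topologicalType) : continuous (@snd T U).
Proof. by move=> x; exact: cvg_snd. Qed.

Lemma comp_within (S T U : topologicalType) (B : set T)
    (h : S -> T) (F : T -> U) :
  (forall a, B (h a)) -> continuous h -> {within B, continuous F} ->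
  continuous (fun s => F (h s)).
Proof.
move=> Bh ch /subspace_sigL_continuousP cF.
pose k (a : S) : set_type B := SigSub (mem_set (Bh a)).
have ck : continuous k by exact: set_type_continuous.
exact: (comp_continuous ck cF).
Qed.

(** The multiplication is a total function which is meaningful on composable
    pairs only: nothing is assumed about it elsewhere.  The unit space is a
    separate type [gobj], embedded in the space of arrows by [gunit].  Local
    compactness is not part of the structure; it holds for the groupoids
    constructed below when the spaces involved are locally compact. *)

Record groupoid := Groupoid {
  garr : topologicalType;
  gobj : topologicalType;
  gsrc : garr -> gobj;
  grng : garr -> gobj;
  gunit : gobj -> garr;
  gmul : garr -> garr -> garr;
  ginv : garr -> garr;
  gsrc_unit : forall x, gsrc (gunit x) = x;
  grng_unit : forall x, grng (gunit x) = x;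
  gsrc_mul : forall a b, gsrc a = grng b -> gsrc (gmul a b) = gsrc b;
  grng_mul : forall a b, gsrc a = grng b -> grng (gmul a b) = grng a;
  gmulA : forall a b c, gsrc a = grng b -> gsrc b = grng c ->
    gmul a (gmul b c) = gmul (gmul a b) c;
  gmul_unitl : forall a, gmul (gunit (grng a)) a = a;
  gmul_unitr : forall a, gmul a (gunit (gsrc a)) = a;
  gsrc_inv : forall a, gsrc (ginv a) = grng a;
  grng_inv : forall a, grng (ginv a) = gsrc a;
  gmul_invl : forall a, gmul (ginv a) a = gunit (gsrc a);
  gmul_invr : forall a, gmul a (ginv a) = gunit (grng a);
  gsrc_continuous : continuous gsrc;
  grng_continuous : continuous grng;
  gunit_continuous : continuous gunit;
  ginv_continuous : continuous ginv;
  gmul_continuous : {within [set ab | gsrc ab.1 = grng ab.2],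
    continuous (fun ab : garr * garr => gmul ab.1 ab.2)} }.

Lemma ginv_mul (G : groupoid) (a b : garr G) : gsrc a = grng b ->
  ginv (gmul a b) = gmul (ginv b) (ginv a).
Proof.
move=> ab.
have sab := gsrc_mul ab; have rab := grng_mul ab.
have ba : gsrc (ginv b) = grng (ginv a) by rewrite gsrc_inv grng_inv.
have E : gmul (gmul (ginv b) (ginv a)) (gmul a b) = gunit (gsrc b).
  rewrite -gmulA ?gsrc_inv ?grng_inv ?rab//.
  rewrite [gmul (ginv a) _]gmulA ?gsrc_inv// gmul_invl ab gmul_unitl.
  exact: gmul_invl.
rewrite -[LHS]gmul_unitl grng_inv sab -E -gmulA ?gmul_invr ?grng_inv//.
  by rewrite rab -[grng a]gsrc_inv -(gsrc_mul ba) gmul_unitr.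
by rewrite (gsrc_mul ba) gsrc_inv rab.
Qed.

(** * Amenability *)

Definition rfiber (G : groupoid) (x : gobj G) : Type :=
  set_type [set a : garr G | grng a = x].

HB.instance Definition _ (G : groupoid) (x : gobj G) :=
  Topological.copy (rfiber x) (set_type [set a : garr G | grng a = x]).
HB.instance Definition _ (G : groupoid) (x : gobj G) :=
  isPointed.Build (rfiber x) (SigSub (mem_set (grng_unit x))).

Definition rfiber_val (G : groupoid) (x : gobj G) (a : rfiber x) : garr G :=
  set_val a.

Definition borel (T : ptopologicalType) := g_sigma_algebraType (@open T).

Lemma gtrans_subproof (G : groupoid) (a : garr G) (b : rfiber (gsrc a)) :
  grng (gmul a (rfiber_val b)) = grng a.
Proof. by apply: grng_mul; rewrite (set_valP b). Qed.

Definition gtrans (G : groupoid) (a : garr G) (b : rfiber (gsrc a)) :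
    rfiber (grng a) :=
  SigSub (mem_set (gtrans_subproof b)).

(** The total variation norm of [mu - nu]. *)
Definition tv_dist d (T : measurableType d) (R : realType)
    (mu nu : set T -> \bar R) : \bar R :=
  ereal_sup [set v | exists (n : nat) (A : 'I_n -> set T),
    [/\ forall i, measurable (A i), trivIset setT A &
        v = (\sum_(i < n) `|mu (A i) - nu (A i)|)%E]].

(** Nets are indexed by a nonempty directed preorder [(I, le)].  [f] ranges over
    the real-valued functions in C_c(G): the complex-valued ones follow by
    linearity.  [pushforward (m i (gsrc a)) (gtrans a)] is the translate of
    [m i (gsrc a)] by the arrow [a], a measure on the fiber over [grng a]. *)
Definition amenable (R : realType) (G : groupoid) : Prop :=
  exists (I : Type) (le : I -> I -> Prop)
    (m : I -> forall x : gobj G, probability (borel (rfiber x)) R),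
  [/\ (exists i : I, True) /\ (forall i, le i i),
      forall i j k, le i j -> le j k -> le i k,
      forall i j, exists k, le i k /\ le j k,
      forall (i : I) (f : garr G -> R), continuous f ->
        compact (closure [set a | f a != 0]) ->
        continuous (fun x : gobj G => \int[m i x]_b f (rfiber_val b)) &
      forall K : set (garr G), compact K -> forall e : R, 0 < e ->
        exists i0, forall i, le i0 i -> forall a, K a ->
          (tv_dist (pushforward (m i (gsrc a))
                      (@gtrans G a : borel _ -> borel (rfiber (grng a))))
                   (m i (grng a)) <= e%:E)%E].

(** * Groupoid spaces *)

Record gspace (G : groupoid) := GSpace {
  gcar : topologicalType;
  gcar_lc : lc_space gcar;
  ganchor : gcar -> gobj G;
  gact : garr G -> gcar -> gcar;
  ganchor_continuous : continuous ganchor;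
  gact_continuous : {within [set ay | gsrc ay.1 = ganchor ay.2],
    continuous (fun ay : garr G * gcar => gact ay.1 ay.2)};
  ganchor_act : forall a y, gsrc a = ganchor y -> ganchor (gact a y) = grng a;
  gact_unit : forall y, gact (gunit (ganchor y)) y = y;
  gact_mul : forall a b y, gsrc a = grng b -> gsrc b = ganchor y ->
    gact (gmul a b) y = gact a (gact b y) }.

Section SemidirectProduct.
Variables (G : groupoid) (Y : gspace G).

Definition sd_set : set (gcar Y * garr G) :=
  [set ya | ganchor ya.1 = grng ya.2].

Definition sd_arr : topologicalType := set_type sd_set.

Let Yof (c : sd_arr) : gcar Y := (set_val c).1.
Let Gof (c : sd_arr) : garr G := (set_val c).2.

Let sdP (c : sd_arr) : ganchor (Yof c) = grng (Gof c).
Proof. exact: (set_valP c). Qed.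

Let sd_eq (c d : sd_arr) : Yof c = Yof d -> Gof c = Gof d -> c = d.
Proof.
move=> h1 h2; apply: val_inj; rewrite -set_valE.
by apply/eqP; rewrite -pair_eqE /pair_eq; apply/andP; split; apply/eqP.
Qed.

Definition sd_rng (c : sd_arr) : gcar Y := (set_val c).1.

Definition sd_src (c : sd_arr) : gcar Y :=
  gact (ginv (set_val c).2) (set_val c).1.

Lemma sd_unit_subproof (y : gcar Y) : sd_set (y, gunit (ganchor y)).
Proof. by rewrite /sd_set /= grng_unit. Qed.

Definition sd_unit (y : gcar Y) : sd_arr :=
  SigSub (mem_set (sd_unit_subproof y)).

Lemma sd_inv_subproof (c : sd_arr) :
  sd_set (sd_src c, ginv (set_val c).2).
Proof.
rewrite /sd_set /= ganchor_act // gsrc_inv; exact/esym/sdP.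
Qed.

Definition sd_inv (c : sd_arr) : sd_arr := SigSub (mem_set (sd_inv_subproof c)).

(* The default value [c] is taken only when [c] and [d] are not composable. *)
Definition sd_mul (c d : sd_arr) : sd_arr :=
  insubd c ((set_val c).1, gmul (set_val c).2 (set_val d).2).

Let sd_srcP c : ganchor (sd_src c) = gsrc (Gof c).
Proof. by rewrite ganchor_act ?grng_inv// gsrc_inv -sdP. Qed.

Let sd_comp c d : sd_src c = sd_rng d -> gsrc (Gof c) = grng (Gof d).
Proof. by move=> cd; rewrite -sd_srcP cd -sdP. Qed.

Let sd_mulE c d : sd_src c = sd_rng d ->
  set_val (sd_mul c d) = (Yof c, gmul (Gof c) (Gof d)).
Proof.
move=> cd; rewrite set_valE /sd_mul insubdK //.
by apply/mem_set; rewrite /sd_set /= grng_mul ?sdP//; exact: sd_comp.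
Qed.

Let Y_mul c d : sd_src c = sd_rng d -> Yof (sd_mul c d) = Yof c.
Proof. by move=> /sd_mulE; rewrite /Yof => ->. Qed.

Let G_mul c d : sd_src c = sd_rng d -> Gof (sd_mul c d) = gmul (Gof c) (Gof d).
Proof. by move=> /sd_mulE; rewrite /Gof => ->. Qed.

Let sd_src_unit y : sd_src (sd_unit y) = y.
Proof.
rewrite /sd_src /=; set u := gunit _.
have -> : ginv u = u.
  rewrite -[LHS]gmul_unitr gsrc_inv grng_unit -[X in gmul _ X]/u gmul_invl.
  by rewrite gsrc_unit.
exact: gact_unit.
Qed.

Let sd_rng_unit y : sd_rng (sd_unit y) = y. Proof. by []. Qed.

Let sd_src_mul c d : sd_src c = sd_rng d -> sd_src (sd_mul c d) = sd_src d.
Proof.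
move=> cd; rewrite /sd_src -/(Gof _) -/(Yof _) Y_mul// G_mul// ginv_mul.
  rewrite gact_mul ?gsrc_inv ?grng_inv.
  - by rewrite -/(sd_src c) cd.
  - exact/esym/sd_comp.
  - exact/esym/sdP.
exact: sd_comp.
Qed.

Let sd_rng_mul c d : sd_src c = sd_rng d -> sd_rng (sd_mul c d) = sd_rng c.
Proof. exact: Y_mul. Qed.

Let sd_mulA c d e : sd_src c = sd_rng d -> sd_src d = sd_rng e ->
  sd_mul c (sd_mul d e) = sd_mul (sd_mul c d) e.
Proof.
move=> cd de.
have h1 : sd_src c = sd_rng (sd_mul d e) by rewrite sd_rng_mul.
have h2 : sd_src (sd_mul c d) = sd_rng e by rewrite sd_src_mul.
apply: sd_eq; first by rewrite !Y_mul.
by rewrite !G_mul// gmulA//; exact: sd_comp.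
Qed.

Let sd_mul_unitl c : sd_mul (sd_unit (sd_rng c)) c = c.
Proof.
have h := sd_src_unit (sd_rng c).
apply: sd_eq; first by rewrite Y_mul.
by rewrite G_mul// {1}/Gof /= -/(Yof c) sdP gmul_unitl.
Qed.

Let sd_mul_unitr c : sd_mul c (sd_unit (sd_src c)) = c.
Proof.
apply: sd_eq; first by rewrite Y_mul.
by rewrite G_mul// {2}/Gof /= sd_srcP gmul_unitr.
Qed.

Let sd_rng_inv c : sd_rng (sd_inv c) = sd_src c. Proof. by []. Qed.

Let sd_src_inv c : sd_src (sd_inv c) = sd_rng c.
Proof.
rewrite {1}/sd_src /= /sd_src -gact_mul ?gsrc_inv ?grng_inv//.
  rewrite gmul_invl gsrc_inv -/(Gof c) -sdP; exact: gact_unit.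
exact/esym/sdP.
Qed.

Let sd_mul_invl c : sd_mul (sd_inv c) c = sd_unit (sd_src c).
Proof.
have h := sd_src_inv c.
apply: sd_eq; first by rewrite Y_mul.
by rewrite G_mul// /Gof /= gmul_invl sd_srcP.
Qed.

Let sd_mul_invr c : sd_mul c (sd_inv c) = sd_unit (sd_rng c).
Proof.
apply: sd_eq; first by rewrite Y_mul.
by rewrite G_mul// /Gof /= gmul_invr -sdP.
Qed.

Let Yof_continuous : continuous Yof.
Proof.
exact: (comp_continuous (@set_val_continuous _ _) (@fst_continuous _ _)).
Qed.

Let Gof_continuous : continuous Gof.
Proof.
exact: (comp_continuous (@set_val_continuous _ _) (@snd_continuous _ _)).
Qed.

Let sd_rng_continuous : continuous sd_rng. Proof. exact: Yof_continuous. Qed.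

Let sd_src_continuous : continuous sd_src.
Proof.
apply: (comp_within (h := fun c : sd_arr => (ginv (Gof c), Yof c)) _ _
  (@gact_continuous G Y)).
- by move=> c /=; rewrite gsrc_inv -sdP.
- apply: pair_continuous => //.
  exact: (comp_continuous Gof_continuous (@ginv_continuous G)).
Qed.

Let sd_unit_continuous : continuous sd_unit.
Proof.
apply: set_type_continuous; apply: (pair_continuous (f := id)).
  by move=> x; exact: cvg_id.
exact: (comp_continuous (@ganchor_continuous G Y) (@gunit_continuous G)).
Qed.

Let sd_inv_continuous : continuous sd_inv.
Proof.
apply: set_type_continuous; apply: (pair_continuous sd_src_continuous).
exact: (comp_continuous Gof_continuous (@ginv_continuous G)).
Qed.

Let sd_mul_continuous : {within [set cd | sd_src cd.1 = sd_rng cd.2],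
  continuous (fun cd : sd_arr * sd_arr => sd_mul cd.1 cd.2)}.
Proof.
set D := [set cd | _]; apply/subspace_sigL_continuousP.
have c1 : continuous (fun w : set_type D => (set_val w).1).
  exact: (comp_continuous (@set_val_continuous _ _) (@fst_continuous _ _)).
have c2 : continuous (fun w : set_type D => (set_val w).2).
  exact: (comp_continuous (@set_val_continuous _ _) (@snd_continuous _ _)).
apply: set_type_continuous.
rewrite (_ : (fun t => _) = fun w : set_type D =>
  (Yof (set_val w).1, gmul (Gof (set_val w).1) (Gof (set_val w).2))); last first.
  by apply/funext => w; rewrite /sigL /= sd_mulE//; exact: (set_valP w).
apply: pair_continuous; first exact: (comp_continuous c1 Yof_continuous).
apply: (comp_within (h := fun w : set_type D =>
  (Gof (set_val w).1, Gof (set_val w).2)) _ _ (@gmul_continuous G)).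
- by move=> w; apply: sd_comp; exact: (set_valP w).
- by apply: pair_continuous;
    [exact: (comp_continuous c1)|exact: (comp_continuous c2)].
Qed.

Definition semidirect : groupoid := @Groupoid sd_arr (gcar Y)
  sd_src sd_rng sd_unit sd_mul sd_inv
  sd_src_unit sd_rng_unit sd_src_mul sd_rng_mul sd_mulA sd_mul_unitl
  sd_mul_unitr sd_src_inv sd_rng_inv sd_mul_invl sd_mul_invr
  sd_src_continuous sd_rng_continuous sd_unit_continuous sd_inv_continuous
  sd_mul_continuous.

End SemidirectProduct.

Definition strongly_amenable_at_infinity (R : realType) (G : groupoid) : Prop :=
  exists Y : gspace G,
  [/\ forall K : set (gobj G), compact K -> compact (@ganchor G Y @^-1` K),
      forall x, exists y, @ganchor G Y y = x,
      exists2 t : gobj G -> gcar Y, continuous t & cancel t (@ganchor G Y) &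
      amenable R (semidirect Y)].

(** * Partial actions *)

Definition homeomorphism_on (X : topologicalType) (A B : set X) (f : X -> X) :=
  exists f' : X -> X,
  [/\ set_fun A B f /\ set_fun B A f',
      {in A, cancel f f'} /\ {in B, cancel f' f},
      {within A, continuous f} & {within B, continuous f'}].

(** [pact g] is only meaningful on [pdom g^-1].  The condition [pact_mul] says
    that [pact (g * h)] extends the composite of [pact g] and [pact h], whose
    domain is the set of points of [pdom h^-1] sent by [pact h] in [pdom g^-1]. *)
Record partial_action (Gam : groupType) (X : topologicalType) := PartialAction {
  pdom : Gam -> set X;
  pact : Gam -> X -> X;
  pdom_open : forall g, open (pdom g);
  pact_homeo : forall g, homeomorphism_on (pdom g^-1%g) (pdom g) (pact g);
  pdom1 : pdom 1%g = setT;
  pact1 : forall x, pact 1%g x = x;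
  pact_mul : forall g h x, pdom h^-1%g x -> pdom g^-1%g (pact h x) ->
    pdom (g * h)^-1%g x /\ pact (g * h)%g x = pact g (pact h x) }.

Section PartialTransformationGroupoid.
Variables (Gam : groupType) (X : topologicalType) (b : partial_action Gam X).

Definition pt_set : set (discrete_topology Gam * X) :=
  [set gx | pdom b (gx.1 : Gam)^-1%g gx.2].

Definition pt_arr : topologicalType := set_type pt_set.

Let gof (c : pt_arr) : Gam := (set_val c).1.
Let xof (c : pt_arr) : X := (set_val c).2.

Let ptP (c : pt_arr) : pdom b (gof c)^-1%g (xof c).
Proof. exact: (set_valP c). Qed.

Let pt_eq (c d : pt_arr) : gof c = gof d -> xof c = xof d -> c = d.
Proof.
move=> h1 h2; apply: val_inj; rewrite -set_valE.
rewrite (surjective_pairing (set_val c)) (surjective_pairing (set_val d)).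
exact: (f_equal2 pair h1 h2).
Qed.

Definition pt_src (c : pt_arr) : X := (set_val c).2.

Definition pt_rng (c : pt_arr) : X := pact b (set_val c).1 (set_val c).2.

Lemma pt_unit_subproof (x : X) : pt_set (1%g, x).
Proof. by rewrite /pt_set /= invg1 pdom1. Qed.

Definition pt_unit (x : X) : pt_arr := SigSub (mem_set (pt_unit_subproof x)).

Let pt_rngP c : pdom b (gof c) (pt_rng c).
Proof. by have [f' [[h _] _ _ _]] := pact_homeo b (gof c); exact/h/ptP. Qed.

Lemma pt_inv_subproof (c : pt_arr) :
  pt_set (((set_val c).1 : Gam)^-1%g, pt_rng c).
Proof. by rewrite /pt_set /= invgK; exact: pt_rngP. Qed.

Definition pt_inv (c : pt_arr) : pt_arr := SigSub (mem_set (pt_inv_subproof c)).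

(* The default value [c] is taken only when [c] and [d] are not composable. *)
Definition pt_mul (c d : pt_arr) : pt_arr :=
  insubd c (((set_val c).1 * (set_val d).1)%g : Gam, (set_val d).2).

Let pt_comp c d : pt_src c = pt_rng d ->
  pdom b (gof c * gof d)^-1%g (xof d) /\
  pact b (gof c * gof d)%g (xof d) = pt_rng c.
Proof.
move=> cd; have := ptP c; rewrite -[xof c]/(pt_src c) cd => h.
by rewrite /pt_rng -[(set_val c).2]/(pt_src c) cd; exact: (pact_mul (ptP d) h).
Qed.

Let pt_mulE c d : pt_src c = pt_rng d ->
  set_val (pt_mul c d) = ((gof c * gof d)%g, xof d).
Proof.
move=> cd; rewrite set_valE /pt_mul insubdK //.
by apply/mem_set; exact: (pt_comp cd).1.
Qed.

Let g_mul c d : pt_src c = pt_rng d -> gof (pt_mul c d) = (gof c * gof d)%g.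
Proof. by move=> cd; rewrite [LHS]/gof pt_mulE. Qed.

Let x_mul c d : pt_src c = pt_rng d -> xof (pt_mul c d) = xof d.
Proof. by move=> cd; rewrite [LHS]/xof pt_mulE. Qed.

Let pt_src_unit x : pt_src (pt_unit x) = x. Proof. by []. Qed.

Let pt_rng_unit x : pt_rng (pt_unit x) = x. Proof. exact: pact1. Qed.

Let pt_src_mul c d : pt_src c = pt_rng d -> pt_src (pt_mul c d) = pt_src d.
Proof. exact: x_mul. Qed.

Let pt_rng_mul c d : pt_src c = pt_rng d -> pt_rng (pt_mul c d) = pt_rng c.
Proof.
move=> cd; rewrite {1}/pt_rng -/(gof _) -/(xof _) g_mul// x_mul//.
exact: (pt_comp cd).2.
Qed.

Let pt_mulA c d e : pt_src c = pt_rng d -> pt_src d = pt_rng e ->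
  pt_mul c (pt_mul d e) = pt_mul (pt_mul c d) e.
Proof.
move=> cd de.
have h1 : pt_src c = pt_rng (pt_mul d e) by rewrite pt_rng_mul.
have h2 : pt_src (pt_mul c d) = pt_rng e by rewrite pt_src_mul.
by apply: pt_eq; rewrite ?g_mul ?x_mul// mulgA.
Qed.

Let pt_mul_unitl c : pt_mul (pt_unit (pt_rng c)) c = c.
Proof. by apply: pt_eq; rewrite ?g_mul ?x_mul// mul1g. Qed.

Let pt_mul_unitr c : pt_mul c (pt_unit (pt_src c)) = c.
Proof.
have h := esym (pt_rng_unit (pt_src c)).
by apply: pt_eq; rewrite ?g_mul ?x_mul// mulg1.
Qed.

Let pt_src_inv c : pt_src (pt_inv c) = pt_rng c. Proof. by []. Qed.

Let pt_rng_inv c : pt_rng (pt_inv c) = pt_src c.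
Proof.
have h : pdom b (gof c)^-1^-1%g (pt_rng c) by rewrite invgK; exact: pt_rngP.
by have [_] := pact_mul (ptP c) h; rewrite mulVg pact1; exact: esym.
Qed.

Let pt_mul_invl c : pt_mul (pt_inv c) c = pt_unit (pt_src c).
Proof. by apply: pt_eq; rewrite ?g_mul ?x_mul// mulVg. Qed.

Let pt_mul_invr c : pt_mul c (pt_inv c) = pt_unit (pt_rng c).
Proof.
have h := esym (pt_rng_inv c).
by apply: pt_eq; rewrite ?g_mul ?x_mul// mulgV.
Qed.

Let gof_continuous : continuous (gof : pt_arr -> discrete_topology Gam).
Proof.
exact: (comp_continuous (@set_val_continuous _ _) (@fst_continuous _ _)).
Qed.

Let xof_continuous : continuous xof.
Proof.
exact: (comp_continuous (@set_val_continuous _ _) (@snd_continuous _ _)).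
Qed.

Let pt_src_continuous : continuous pt_src. Proof. exact: xof_continuous. Qed.

Let pt_rng_continuous : continuous pt_rng.
Proof.
move=> c V /= nV.
have [_ [_ _ + _]] := pact_homeo b (gof c).
rewrite continuous_open_subspace; last exact: pdom_open.
move=> /(_ (xof c) (mem_set (ptP c))) /(_ _ nV) /= nU.
have h1 : nbhs c [set d | V (pact b (gof c) (xof d))] := xof_continuous nU.
have h2 : nbhs c [set d | gof d = gof c] :=
  gof_continuous (discrete_set1 (gof c : discrete_topology Gam)).
change (nbhs c (pt_rng @^-1` V)).
apply: filterS (filterI h1 h2) => d [/= Vd gd].
by rewrite /pt_rng -/(gof d) -/(xof d) (gd : gof d = gof c).
Qed.

Let discrete_continuous (S : topologicalType)
  (f : discrete_topology Gam -> S) : continuous f.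
Proof.
move=> g V /nbhs_singleton Vg; change (nbhs g (f @^-1` V)).
have h : nbhs g [set g] := discrete_set1 g.
by apply: (@filterS _ (nbhs g) _ [set g] (f @^-1` V) _ h) => g' ->.
Qed.

Let pt_unit_continuous : continuous pt_unit.
Proof.
apply: (set_type_continuous (f := pt_unit)).
apply: (pair_continuous (U := discrete_topology Gam) (g := id)).
  by move=> x; exact: cvg_cst.
by move=> x; exact: cvg_id.
Qed.

Let pt_inv_continuous : continuous pt_inv.
Proof.
apply: (set_type_continuous (f := pt_inv)).
apply: (pair_continuous (U := discrete_topology Gam) _ pt_rng_continuous).
exact: (comp_continuous gof_continuous (discrete_continuous
  (f := fun g : discrete_topology Gam => (g : Gam)^-1%g : discrete_topology Gam))).
Qed.

Let mulg_continuous : continuous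
  (fun gh : discrete_topology Gam * discrete_topology Gam =>
    ((gh.1 : Gam) * (gh.2 : Gam))%g : discrete_topology Gam).
Proof.
move=> [g h] V /nbhs_singleton /= Vg; exists ([set g], [set h]) => /=.
  by split; exact: discrete_set1.
by move=> [g' h'] /= [-> ->].
Qed.

Let pt_mul_continuous : {within [set cd | pt_src cd.1 = pt_rng cd.2],
  continuous (fun cd : pt_arr * pt_arr => pt_mul cd.1 cd.2)}.
Proof.
set D := [set cd | _]; apply/subspace_sigL_continuousP.
have c1 : continuous (fun w : set_type D => (set_val w).1).
  exact: (comp_continuous (@set_val_continuous _ _) (@fst_continuous _ _)).
have c2 : continuous (fun w : set_type D => (set_val w).2).
  exact: (comp_continuous (@set_val_continuous _ _) (@snd_continuous _ _)).
apply: set_type_continuous.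
rewrite (_ : (fun t => _) = fun w : set_type D =>
  ((gof (set_val w).1 * gof (set_val w).2)%g : discrete_topology Gam,
   xof (set_val w).2)); last first.
  by apply/funext => w; rewrite /sigL /= pt_mulE//; exact: (set_valP w).
apply: pair_continuous; last exact: (comp_continuous c2 xof_continuous).
apply: (comp_continuous (f := fun w : set_type D =>
  (gof (set_val w).1 : discrete_topology Gam,
   gof (set_val w).2 : discrete_topology Gam)) _ mulg_continuous).
by apply: pair_continuous;
    [exact: (comp_continuous c1)|exact: (comp_continuous c2)].
Qed.

Definition partial_transformation_groupoid : groupoid := @Groupoid pt_arr X
  pt_src pt_rng pt_unit pt_mul pt_inv
  pt_src_unit pt_rng_unit pt_src_mul pt_rng_mul pt_mulA pt_mul_unitl
  pt_mul_unitr pt_src_inv pt_rng_inv pt_mul_invl pt_mul_invr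
  pt_src_continuous pt_rng_continuous pt_unit_continuous pt_inv_continuous
  pt_mul_continuous.

End PartialTransformationGroupoid.

(** A partial action all of whose domains are the whole space is an action; its
    partial transformation groupoid is the usual transformation groupoid.
    Without [[set: Z] !=set0], every group would be exact. *)
Definition exact_group (R : realType) (Gam : groupType) : Prop :=
  exists (Z : topologicalType) (b : partial_action Gam Z),
  [/\ lc_space Z, compact [set: Z], [set: Z] !=set0,
      forall g, pdom b g = setT &
      amenable R (partial_transformation_groupoid b)].

(* Main.v *)
From HB Require Import structures.
Require Import Defs.
From mathcomp Require Import all_boot all_order all_algebra.
From mathcomp Require Import all_classical all_reals all_analysis.
From mathcomp Require Import measurable_realfun lra ring.
Set Implicit Arguments.
Unset Strict Implicit.
Unset Printing Implicit Defensive.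
Import Order.TTheory GRing.Theory Num.Theory.
Import numFieldNormedType.Exports.
Local Open Scope classical_set_scope.
Local Open Scope ring_scope.

(** Let [Z] be a compact space with an amenable action of the exact group [Gam].
    The space [X * Z], fibered over [X] by the first projection, carries the
    diagonal partial action, and it remains to see that it is amenable.  On [Z]
    there are almost invariant probabilities [zeta z], supported in a fixed finite
    set [F], but the fiber over [(x, z)] only consists of the [k] with [x] in
    [pdom b k], and membership in [pdom b k] is not continuous in [x].  The mass
    at [g] is therefore moved to the points [g h^-1], [h] in [F], with weights
    proportional to [chi x (g h^-1)], where [chi x k] is continuous in [x],
    vanishes off [pdom b k] and satisfies [chi x 1 = 1].  The total weight is at
    least [1] since [h = g] is allowed, so only the finite set [F F^-1] matters,
    and the result is almost invariant on a compact set [K] of arrows as soon as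
    [chi] varies by at most [1 / N] under [K], with [N] large compared to the size
    of [F].  Such a [chi] is the average over [n < N] of the degrees to which [k]
    is reached from [1] in [n] steps taken in [K]. *)

(** * Cutoff functions along a partial action *)

(** This is Urysohn's lemma in the one-point compactification, which is compact Hausdorff and hence
    normal: there the image of [C] is closed and that of [U] is open. *)
Lemma lc_compact_separation (R : realType) (X : topologicalType) (C U : set X) :
  lc_space X -> compact C -> open U -> C `<=` U ->
  exists f : X -> R, [/\ continuous f, forall x, 0 <= f x <= 1,
    forall x, C x -> f x = 1 & forall x, ~ U x -> f x = 0].
Proof.
move=> [hX lcX _] cC oU CU.
pose opc := one_point_compactification X.
have hopc : hausdorff_space opc.
  exact: one_point_compactification_hausdorff.
have nopc : normal_space opc.
  exact: compact_normal hopc (@one_point_compactification_compact X).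
have cs := @one_point_compactification_some_continuous X.
have clC : @closed opc (Some @` C).
  apply: (compact_closed hopc); apply: continuous_compact => //.
  exact: continuous_subspaceT.
have clU : @closed opc (~` (Some @` U)).
  by apply: open_closedC; exact: one_point_compactification_open_some.
have CU0 : (~` (Some @` U) : set opc) `&` (Some @` C) = set0.
  rewrite -subset0 => y [nU [x Cx xy]]; apply: nU; exists x => //; exact: CU.
have /(uniform_separatorP (R := R)) [f [cf f01 f0 f1]] :=
  (normal_separatorP (R := R)).1 nopc _ _ clU clC CU0.
exists (fun x => f (Some x)); split.
- exact: (comp_continuous cs cf).
- by move=> x; have /= := f01 (f (Some x)) (ex_intro2 _ _ _ I erefl);
    rewrite in_itv.
- by move=> x Cx; apply: f1; exists (Some x) => //; exists x.
- by move=> x nUx; apply: f0; exists (Some x) => // -[y Uy [yx]]; apply: nUx;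
    rewrite -yx.
Qed.

Lemma continuous_sum (R : realType) (T : topologicalType) (I : eqType)
    (r : seq I) (F : I -> T -> R) :
  (forall i, i \in r -> continuous (F i)) ->
  continuous (fun x => \sum_(i <- r) F i x).
Proof.
move=> cF; rewrite (_ : (fun x => _) = fun x => \sum_(i <- r | i \in r) F i x).
  by apply: continuous_big => //; exact: add_continuous.
by apply/funext => x; rewrite big_seq.
Qed.

(** Outside [U] the product is dominated by [M * |u|], which tends to 0. The lemma serves for
    functions [v] that are composed with a partially defined map and multiplied by a weight
    vanishing off its domain. *)
Lemma continuous_vanishing_mul (R : realType) (T : topologicalType) (U : set T)
    (u v : T -> R) (M : R) :
  (forall x, `|v x| <= M) -> (forall x, U x -> {for x, continuous v}) ->
  continuous u -> (forall x, ~ U x -> u x = 0) ->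
  continuous (fun x => u x * v x).
Proof.
move=> vM cv cu u0 x; have [Ux|nUx] := pselect (U x).
  by apply: cvgM; [exact: cu|exact: cv].
rewrite /continuous_at u0// mul0r; apply/norm_cvg0P.
have lim0 : `|u y| * M @[y --> x] --> 0.
  rewrite -[0](mul0r M) -(normr0 R) -(u0 x nUx).
  by apply: cvgMl; apply: cvg_norm; exact: cu.
apply: squeeze_cvgr lim0; last exact: cvg_cst.
by apply: nearW => y; rewrite normr_ge0 normrM ler_wpM2l.
Qed.

(** * Domains and inverses of a partial action *)

Section Pact.
Variables (Gam : groupType) (X : topologicalType) (b : partial_action Gam X).

Lemma pact_dom (g : Gam) x : pdom b g^-1%g x -> pdom b g (pact b g x).
Proof. by have [f' [[h _] _ _ _]] := pact_homeo b g; exact: h. Qed.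

Lemma pactK (g : Gam) x : pdom b g^-1%g x -> pact b g^-1%g (pact b g x) = x.
Proof.
move=> gx; have h : pdom b (g^-1)^-1%g (pact b g x) by rewrite invgK;
  exact: pact_dom.
by have [_ <-] := pact_mul gx h; rewrite mulVg pact1.
Qed.

Lemma pactVK (g : Gam) x : pdom b g x -> pact b g (pact b g^-1%g x) = x.
Proof. by move=> gx; rewrite -{1}[g]invgK pactK// invgK. Qed.

Lemma pact_continuous_at (g : Gam) x : pdom b g^-1%g x ->
  {for x, continuous (pact b g)}.
Proof.
move=> gx; have [_ [_ _ + _]] := pact_homeo b g.
rewrite continuous_open_subspace; last exact: pdom_open.
by apply; exact/mem_set.
Qed.

(** With [g = s^-1 * k], the point [x] is obtained by applying [g] and then [s] to some point, so it
    lies in the range of [s * g = k]. *)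
Lemma pdom_pactV (s k : Gam) x : pdom b s x ->
  pdom b (s^-1 * k)%g (pact b s^-1%g x) -> pdom b k x.
Proof.
move=> sx h.
have h1 : pdom b s^-1%g (pact b s^-1%g x) by apply: pact_dom; rewrite invgK.
set g := (s^-1 * k)%g in h.
have h2 : pdom b g^-1%g (pact b g^-1%g (pact b s^-1%g x)).
  by apply: pact_dom; rewrite invgK.
have [h3 h4] : pdom b (s * g)^-1%g (pact b g^-1%g (pact b s^-1%g x)) /\
    pact b (s * g)%g (pact b g^-1%g (pact b s^-1%g x)) =
    pact b s (pact b g (pact b g^-1%g (pact b s^-1%g x))).
  by apply: pact_mul => //; rewrite pactVK.
have -> : k = (s * g)%g by rewrite /g mulgA mulgV mul1g.
have -> : x = pact b (s * g)%g (pact b g^-1%g (pact b s^-1%g x)).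
  by rewrite h4 !pactVK.
exact: pact_dom.
Qed.
End Pact.

Section Cutoff.
Variables (R : realType) (Gam : groupType) (X : topologicalType).
Variables (b : partial_action Gam X) (T : seq Gam) (kap : Gam -> X -> R).
Hypothesis kap_cont : forall t, continuous (kap t).
Hypothesis kap01 : forall t x, 0 <= kap t x <= 1.
Hypothesis kap0 : forall t x, ~ pdom b t x -> kap t x = 0.

(** A continuous substitute for "[k] is a product of at most [n] elements [t] of
    [T], applied successively along the orbit ending at [x]", each step being
    weighted by [kap t]. *)
Fixpoint reach (n : nat) (k : Gam) (x : X) : R :=
  if n is m.+1 then
    foldr (fun t acc => Num.max acc
      (kap t x * reach m (t^-1 * k)%g (pact b t^-1%g x))) (reach m k x) T
  else (k == 1%g)%:R.

Lemma reach01 n k x : 0 <= reach n k x <= 1.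
Proof.
elim: n k x => [|n IH] k x /=; first by case: (_ == _); rewrite ?lexx ?ler01.
elim: T => [|t T' IHT] /=; first exact: IH.
move: IHT => /andP[h0 h1]; rewrite le_max h0 ge_max h1 /=.
have /andP[a0 a1] := kap01 t x.
have /andP[c0 c1] := IH (t^-1 * k)%g (pact b t^-1%g x).
by rewrite mulr_ile1.
Qed.

(** A step [t] counts only if [x] is in [pdom b t]; [pdom_pactV] then carries the vanishing of the
    previous stage over to [x]. *)
Lemma reach_dom n k x : ~ pdom b k x -> reach n k x = 0.
Proof.
elim: n k x => [|n IH] k x nk /=.
  by case: eqP nk => // -> []; rewrite pdom1.
elim: T => [|t T' IHT] /=; first exact: IH.
rewrite IHT; have [tx|ntx] := pselect (pdom b t x); last first.
  by rewrite kap0// mul0r maxxx.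
rewrite IH ?mulr0 ?maxxx// => h; exact: nk (pdom_pactV tx h).
Qed.

(** The previous stage is evaluated at a translate of [x] that is continuous on [pdom b t] only, but
    its weight [kap t] vanishes off this open set. *)
Lemma reach_continuous n k : continuous (reach n k).
Proof.
elim: n k => [|n IH] k /=; first by move=> x; exact: cvg_cst.
elim: T => [|t T' IHT] /=; first exact: IH.
apply: (max_fun_continuous (f := fun x => foldr _ _ T') IHT).
apply: (@continuous_vanishing_mul R X (pdom b t) _ _ 1) => //.
- by move=> x; have /andP[h0 h1] := reach01 n (t^-1 * k)%g (pact b t^-1%g x);
    rewrite ger0_norm.
- move=> x tx; apply: continuous_comp; last exact: IH.
  by apply: pact_continuous_at; rewrite invgK.
- exact: kap0.
Qed.

Lemma reach_le n k x : reach n k x <= reach n.+1 k x.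
Proof.
by rewrite /=; elim: T => [|t T' IHT] /=; rewrite ?lexx// le_max IHT.
Qed.

Lemma reach_step n t k x : t \in T -> kap t x = 1 ->
  reach n (t^-1 * k)%g (pact b t^-1%g x) <= reach n.+1 k x.
Proof.
move=> + kt /=; elim: T => [|u T' IHT] //=.
rewrite inE => /orP[/eqP <-|/IHT h]; last by rewrite le_max h.
by rewrite kt mul1r le_max lexx orbT.
Qed.

Lemma reach1 n x : reach n 1%g x = 1.
Proof.
elim: n => [|n IH]; first by rewrite /= eqxx.
by apply/eqP; rewrite eq_le (andP (reach01 _ _ _)).2/= -[leLHS]IH reach_le.
Qed.

(** Translation by one step shifts the index of [reach] by one, and the average over [N.+1]
    consecutive indices changes little under such a shift. *)
Definition cutoff (N : nat) (k : Gam) (x : X) : R :=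
  N.+1%:R^-1 * \sum_(0 <= n < N.+1) reach n k x.

Lemma cutoff01 N k x : 0 <= cutoff N k x <= 1.
Proof.
rewrite /cutoff mulr_ge0//=; last first.
  by apply: sumr_ge0 => i _; have /andP[] := reach01 i k x.
rewrite ler_pdivrMl// mulr1 (le_trans (ler_sum_nat (G := fun=> 1) _))//.
  by move=> i _; have /andP[] := reach01 i k x.
by rewrite big_const_nat iter_addr addr0 subn0.
Qed.

Lemma cutoff_dom N k x : ~ pdom b k x -> cutoff N k x = 0.
Proof.
by move=> kx; rewrite /cutoff big1 ?mulr0// => i _; exact: reach_dom.
Qed.

Lemma cutoff_continuous N k : continuous (cutoff N k).
Proof.
move=> x; apply: cvgM; first exact: cvg_cst.
by apply: continuous_sum => i _; exact: reach_continuous.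
Qed.

Lemma cutoff1 N x : cutoff N 1%g x = 1.
Proof.
rewrite /cutoff (eq_bigr (fun=> 1)); last by move=> i _; exact: reach1.
by rewrite big_const_nat iter_addr addr0 subn0 mulVf// pnatr_eq0.
Qed.

(** By [reach_step] the term [n] on the left is at most the term [n.+1] on the right. The last term
    on the left has no partner; it is at most 1 and costs [N.+1%:R^-1]. *)
Lemma cutoff_step N t k x : t \in T -> kap t x = 1 ->
  cutoff N (t^-1 * k)%g (pact b t^-1%g x) <= cutoff N k x + N.+1%:R^-1.
Proof.
move=> tT kt; rewrite /cutoff -[X in _ + X]mulr1 -mulrDr ler_wpM2l//.
rewrite big_nat_recr//= lerD//; last by have /andP[] :=
  reach01 N (t^-1 * k)%g (pact b t^-1%g x).
rewrite [leRHS]big_nat_recl//= -[leLHS]add0r lerD//.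
by apply: ler_sum_nat => i _; exact: reach_step.
Qed.
End Cutoff.

(** * Almost invariant functions on an exact group *)

(** The net can be indexed by the pairs [(K, e)] themselves, ordered by enlarging [K] and shrinking
    [e], with one system of measures chosen for each pair. Amenability thus becomes a statement
    about a single compact set and a single tolerance. *)
Lemma amenableP (R : realType) (G : groupoid) : amenable R G <->
  forall (K : set (garr G)) (e : R), compact K -> 0 < e ->
  exists m : forall x : gobj G, probability (borel (rfiber x)) R,
  (forall f : garr G -> R, continuous f ->
     compact (closure [set a | f a != 0]) ->
     continuous (fun x : gobj G => \int[m x]_b f (rfiber_val b))) /\
  (forall a, K a -> (tv_dist (pushforward (m (gsrc a))
                      (@gtrans G a : borel _ -> borel (rfiber (grng a))))
                   (m (grng a)) <= e%:E)%E).
Proof.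
split=> [[I [le [m [[_ refl] _ _ cm tvm]]]] K e cK e0|H].
  have [i0 h] := tvm K cK e e0.
  by exists (m i0); split; [exact: cm|exact: h].
pose I := {Ke : set (garr G) * R | compact Ke.1 /\ 0 < Ke.2}.
pose le (i j : I) := (sval i).1 `<=` (sval j).1 /\ (sval j).2 <= (sval i).2.
have /choice [m mP] : forall i : I, exists
    m : forall x : gobj G, probability (borel (rfiber x)) R,
  (forall f : garr G -> R, continuous f ->
     compact (closure [set a | f a != 0]) ->
     continuous (fun x : gobj G => \int[m x]_b f (rfiber_val b))) /\
  (forall a, (sval i).1 a -> (tv_dist (pushforward (m (gsrc a))
                      (@gtrans G a : borel _ -> borel (rfiber (grng a))))
                   (m (grng a)) <= (sval i).2%:E)%E).
  by move=> [[K e] [/= cK e0]]; exact: H.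
exists I, le, m; split.
- split; last by move=> i; split.
  by exists (exist _ (set0, 1) (conj (@compact0 _) ltr01)).
- by move=> i j k [ij1 ij2] [jk1 jk2]; split;
    [exact: subset_trans jk1|exact: le_trans ij2].
- move=> [[K e] [/= cK e0]] [[K' e'] [/= cK' e0']].
  have h : compact (K `|` K', Num.min e e').1 /\ 0 < (K `|` K', Num.min e e').2.
    by split=> /=; [exact: compactU|rewrite lt_min e0].
  exists (exist _ (K `|` K', Num.min e e') h); split; split => /=.
  + exact: subsetUl.
  + by rewrite ge_min lexx.
  + exact: subsetUr.
  + by rewrite ge_min lexx orbT.
- by move=> i; exact: (mP i).1.
- move=> K cK e e0; exists (exist _ (K, e) (conj cK e0)) => i [/= Ki ei] a Ka.
  by apply: le_trans ((mP i).2 a (Ki _ Ka)) _; rewrite lee_fin.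
Qed.

(** A continuous injection into a discrete space makes the fiber discrete, so that every subset of
    it is open. *)
Lemma rfiber_measurable (G : groupoid) (x : gobj G) (T : choiceType)
    (p : garr G -> discrete_topology T) (A : set (rfiber x)) :
  continuous p ->
  (forall b c : rfiber x, p (rfiber_val b) = p (rfiber_val c) -> b = c) ->
  measurable (A : set (borel (rfiber x))).
Proof.
move=> cp pinj; apply: sub_sigma_algebra.
have -> : A = (fun b => p (rfiber_val b)) @^-1` [set p (rfiber_val b) | b in A].
  apply/seteqP; split=> [b Ab|b [c Ac /pinj <-]] //; by exists b.
have cb : continuous (fun b : rfiber x => p (rfiber_val b)).
  exact: (comp_continuous (@set_val_continuous _ _) cp).
by move/continuousP: cb; apply; exact: discrete_open.
Qed.

(** * The group coordinate of an arrow *)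

Section GroupCocycle.
Variables (Gam : groupType) (X : topologicalType) (b : partial_action Gam X).
Local Notation G := (partial_transformation_groupoid b).

Definition pt_group (a : garr G) : discrete_topology Gam := (set_val a).1.

Lemma pt_group_continuous : continuous pt_group.
Proof. exact: (comp_continuous (@set_val_continuous _ _) (@fst_continuous _
  _)). Qed.

Lemma pt_group_dom (a : garr G) : pdom b ((pt_group a : Gam)^-1)%g (gsrc a).
Proof. exact: (set_valP a). Qed.

Lemma pt_group_rng (a : garr G) : grng a = pact b (pt_group a) (gsrc a).
Proof. by []. Qed.

Lemma pt_group_src (a : garr G) : gsrc a = pact b (pt_group a :
  Gam)^-1%g (grng a).
Proof. by rewrite pt_group_rng pactK//; exact: pt_group_dom. Qed.

Lemma pt_group_mul (a c : garr G) : gsrc a = grng c ->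
  pt_group (gmul a c) = ((pt_group a : Gam) * pt_group c)%g.
Proof.
move=> ac; rewrite /pt_group /= /pt_mul set_valE insubdK //.
apply/mem_set; rewrite /pt_set /=.
have ha := pt_group_dom a; rewrite ac in ha.
by have [] := pact_mul (pt_group_dom c) ha.
Qed.

Lemma pt_arr_eq (a c : garr G) : grng a = grng c ->
  pt_group a = pt_group c -> a = c.
Proof.
move=> rac gac.
have sac : gsrc a = gsrc c by rewrite !pt_group_src rac gac.
apply: val_inj; rewrite -set_valE.
rewrite (surjective_pairing (set_val a)) (surjective_pairing (set_val c)).
exact: (f_equal2 pair gac sac).
Qed.

Lemma pt_rfiber_inj (x : X) (u v : @rfiber G x) :
  pt_group (rfiber_val u) = pt_group (rfiber_val v) -> u = v.
Proof.
move=> h; apply: val_inj; rewrite -set_valE; apply: pt_arr_eq => //.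
by rewrite (set_valP u) (set_valP v).
Qed.
End GroupCocycle.

(** * Truncation of a mass distribution to a finite set *)

Section Truncation.
Variables (R : realType) (Gam : groupType).

(** The mass missing on [F] is added at the identity rather than removed by rescaling: the total
    becomes 1 without a division, and only finitely many values of [f] are involved. *)
Definition trunc (F : seq Gam) (f : Gam -> R) (g : Gam) : R :=
  if g \in F then f g + (g == 1%g)%:R * (1 - \sum_(h <- F) f h) else 0.

Variables (F : seq Gam) (f : Gam -> R) (e : R).
Hypothesis uF : uniq F.
Hypothesis F1 : 1%g \in F.
Hypothesis f0 : forall g, 0 <= f g.
Hypothesis f1 : forall L : seq Gam, uniq L -> \sum_(g <- L) f g <= 1.
Hypothesis fe : 1 - e <= \sum_(g <- F) f g.

Lemma trunc_ge0 g : 0 <= trunc F f g.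
Proof.
by rewrite /trunc; case: ifP => // _; rewrite addr_ge0// mulr_ge0// subr_ge0 f1.
Qed.

Lemma sum_eq1 (L : seq Gam) : uniq L ->
  \sum_(g <- L) ((g == 1%g)%:R : R) = (1%g \in L)%:R.
Proof.
move=> uL; case: (boolP (1%g \in L)) => h1.
  by rewrite (bigD1_seq 1%g)//= eqxx big1 ?addr0// => i /negbTE ->.
by rewrite big1_seq// => i /= iL; case: eqP iL h1 => // -> ->.
Qed.

Lemma sum_trunc : \sum_(g <- F) trunc F f g = 1.
Proof.
rewrite /trunc [LHS](eq_big_seq (fun g =>
  f g + (g == 1%g)%:R * (1 - \sum_(h <- F) f h))); last by move=> g ->.
by rewrite big_split/= -mulr_suml sum_eq1// F1 mul1r addrC subrK.
Qed.

(** Let [d <= e] be the mass missing on [F]. Truncation adds [d] at the identity and deletes the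
    mass outside [F], which is at most [d] as well. *)
Lemma trunc_close (L : seq Gam) : uniq L ->
  \sum_(g <- L) `|trunc F f g - f g| <= 2 * e.
Proof.
move=> uL; set d := 1 - \sum_(h <- F) f h.
have d0 : 0 <= d by rewrite subr_ge0 f1.
have de : d <= e by rewrite lerBlDr -lerBlDl.
pose L' := [seq g <- L | g \notin F].
have uL' : uniq (F ++ L').
  rewrite cat_uniq uF filter_uniq// andbT /=.
  by apply/hasPn => g; rewrite mem_filter => /andP[].
have h1 : \sum_(g <- L) `|trunc F f g - f g| <=
    \sum_(g <- L) ((g == 1%g)%:R * d + (if g \notin F then f g else 0)).
  apply: ler_sum => g _; rewrite /trunc -/d; case: (boolP (g \in F)) => gF /=.
    by rewrite addr0 addrAC subrr add0r ger0_norm// mulr_ge0.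
  by rewrite sub0r normrN ger0_norm// lerDr mulr_ge0.
apply: le_trans h1 _; rewrite big_split/= -mulr_suml sum_eq1// -big_mkcond
  -big_filter -/L'.
have := f1 uL'; rewrite big_cat/= -/L'.
have : (1%g \in L)%:R * d <= d by rewrite ler_piMl// lern1; case: (_ \in _).
have : \sum_(h <- F) f h = 1 - d by rewrite /d opprB addrC subrK.
move: (\sum_(i <- L') f i) ((1%g \in L)%:R * d) => u v -> h2 h3.
by move: d d0 de h2 h3 => d'; lra.
Qed.
End Truncation.

(** * Measures on the fibers as mass distributions on the group *)

Section GroupMass.
Variables (R : realType) (Gam : groupType) (Z : topologicalType).
Variable c : partial_action Gam Z.
Local Notation G := (partial_transformation_groupoid c).
Variable m : forall z : gobj G, probability (borel (rfiber z)) R.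

Definition group_slice (z : gobj G) (A : set Gam) : set (borel (rfiber z)) :=
  [set u : rfiber z | A (pt_group (rfiber_val u))].
Arguments group_slice : clear implicits.

Definition group_mass (z : gobj G) (A : set Gam) : R :=
  fine (m z (group_slice z A)).

Lemma group_slice_measurable z A : measurable (group_slice z A).
Proof.
apply: rfiber_measurable; first exact: (@pt_group_continuous _ _ c).
exact: pt_rfiber_inj.
Qed.

Lemma group_massE z A : m z (group_slice z A) = (group_mass z A)%:E.
Proof. by rewrite fineK// fin_num_measure//; exact: group_slice_measurable. Qed.

Lemma group_mass_ge0 z A : 0 <= group_mass z A.
Proof. by rewrite fine_ge0. Qed.

Lemma group_massT z : group_mass z setT = 1.
Proof.
rewrite /group_mass (_ : group_slice z setT = setT) ?probability_setT//.
Qed.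

Lemma le_group_mass z A B : A `<=` B -> group_mass z A <= group_mass z B.
Proof.
move=> AB; rewrite -lee_fin -!group_massE; apply: le_measure.
- by rewrite inE; exact: group_slice_measurable.
- by rewrite inE; exact: group_slice_measurable.
- by move=> u; exact: AB.
Qed.

Lemma group_massU z A B : A `&` B = set0 ->
  group_mass z (A `|` B) = group_mass z A + group_mass z B.
Proof.
move=> AB; apply: EFin_inj; rewrite EFinD -!group_massE.
rewrite (_ : group_slice z (A `|` B) = group_slice z A `|` group_slice z B)//.
rewrite measureU//; try exact: group_slice_measurable.
rewrite -subset0 => u [uA uB]; have : (A `&` B) (pt_group (rfiber_val u)) by [].
by rewrite AB.
Qed.

Lemma group_mass_seq z (L : seq Gam) : uniq L ->
  group_mass z [set` L] = \sum_(g <- L) group_mass z [set g].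
Proof.
elim: L => [_|g L IH /= /andP[gL uL]].
  rewrite big_nil /group_mass (_ : group_slice z _ = set0) ?measure0//.
  by rewrite -subset0 => u; rewrite /group_slice /= in_nil.
rewrite big_cons -IH// -group_massU//.
  by congr group_mass; apply/seteqP; split=> h /=; rewrite inE => /predU1P.
rewrite -subset0 => h [/= -> hL].
by rewrite hL in gL.
Qed.

Lemma group_mass_le1 z (L : seq Gam) : uniq L ->
  \sum_(g <- L) group_mass z [set g] <= 1.
Proof. by move=> uL; rewrite -group_mass_seq// -(group_massT z);
  exact: le_group_mass. Qed.

Lemma discrete_fun_continuous (T : topologicalType)
  (f : discrete_topology Gam -> T) : continuous f.
Proof. by apply/continuousP => A _; exact: discrete_open. Qed.

(** For a global action the arrows form the whole product of the group and [Z], and the slice is the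
    image of the compact set [A * Z]. *)
Lemma group_slice_compact (A : set Gam) : (forall g, pdom c g = setT) ->
  compact [set: Z] -> finite_set A ->
  compact [set a : garr G | A (pt_group a)].
Proof.
move=> full cZ fA.
have h (gz : discrete_topology Gam * Z) :
  pt_set c gz by rewrite /pt_set /= full.
pose k (gz : discrete_topology Gam * Z) : garr G := SigSub (mem_set (h gz)).
have ck : continuous k.
  apply: (set_type_continuous (f := k)) => x; exact: cvg_id.
have -> : [set a : garr G | A (pt_group a)] =
    k @` ((A : set (discrete_topology Gam)) `*` setT).
  apply/seteqP; split=> [a Aa|_ [[g z] [/= Ag _] <-]] //.
  exists (set_val a) => //; exact: val_inj.
apply: continuous_compact; first exact: continuous_subspaceT.
by apply: compact_setX => //; exact: finite_compact.
Qed.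

Hypothesis full : forall g, pdom c g = setT.
Hypothesis cZ : compact [set: Z].
Hypothesis mc : forall f : garr G -> R, continuous f ->
  compact (closure [set a | f a != 0]) ->
  continuous (fun x : gobj G => \int[m x]_b f (rfiber_val b)).

(** The indicator of the slice over [A] is continuous with compact support, and its integral is the
    mass in question. *)
Lemma group_mass_continuous A : finite_set A ->
  continuous (fun z : Z => group_mass z A).
Proof.
move=> fA; pose f (a : garr G) : R := \1_A (pt_group a : Gam).
have cf : continuous f.
  apply: (comp_continuous (@pt_group_continuous _ _ c)
    (@discrete_fun_continuous _ (\1_A : discrete_topology Gam -> R))).
have E : [set a | f a != 0] = [set a : garr G | A (pt_group a)].
  apply/seteqP; split=> a /=; rewrite /f indicE.
    by case: (boolP (_ \in A)) => [/set_mem//|]; rewrite eqxx.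
  by move=> /mem_set ->; rewrite oner_eq0.
have clA : closed [set a : garr G | A (pt_group a)].
  have /continuous_closedP := @pt_group_continuous _ _ c; apply.
  exact: discrete_closed.
have := mc cf; rewrite E -(closure_id _).1// =>
  /(_ (group_slice_compact full cZ fA)).
rewrite (_ : (fun x => _) = (fun z : Z => group_mass z A))//; apply/funext => z.
rewrite /Rintegral /group_mass -(setIT (group_slice z A)).
by rewrite -integral_indic//; exact: group_slice_measurable.
Qed.

End GroupMass.

Arguments group_slice {Gam Z c} z A.

Lemma countable_exhaustion (T : choiceType) : countable [set: T] ->
  exists F : nat -> seq T, [/\ forall n, uniq (F n),
    nondecreasing_seq (fun n => [set` F n]) & forall x, exists n, x \in F n].
Proof.
move=> /countable_injP[f finj].
have fin n : finite_set [set x | (f x < n)%N].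
  apply: (@finite_preimage _ _ `I_n f); last exact: finite_II.
  by move=> x y _ _; apply: finj; rewrite inE.
have /choice[F FP] : forall n, exists s :
  seq T, uniq s /\ [set` s] = [set x | (f x < n)%N].
  by move=> n; have /finite_seqP[s sE] := fin n; exists (undup s);
    rewrite undup_uniq; split=> //; rewrite sE; apply/seteqP; split=> x /=;
      rewrite mem_undup.
have FE n x : (x \in F n) = (f x < n)%N.
  by apply/idP/idP => h; have /seteqP[h1 h2] := (FP n).2; [exact: h1|exact: h2].
exists F; split; first by move=> n; exact: (FP n).1.
- by move=> i j ij; apply/subsetPset => x /=; rewrite !FE => /leq_trans; apply.
- by move=> x; exists (f x).+1; rewrite FE.
Qed.

(** * Translation and uniform tightness of the masses *)

Section Tightness.
Variables (R : realType) (Gam : groupType) (Z : topologicalType).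
Variable c : partial_action Gam Z.
Local Notation G := (partial_transformation_groupoid c).
Variable m : forall z : gobj G, probability (borel (rfiber z)) R.

(** The slices over the single elements [pt_group a * g], with [g] in [L], are one of the finite
    disjoint families over which [tv_dist] takes its supremum. *)
Lemma group_mass_translate (a : garr G) (L : seq Gam) : uniq L ->
  ((\sum_(g <- L) `|group_mass m (gsrc a) [set g] -
     group_mass m (grng a) [set ((pt_group a : Gam) * g)%g]|)%:E <=
  tv_dist (pushforward (m (gsrc a))
      (@gtrans G a : borel _ -> borel (rfiber (grng a)))) (m (grng a)))%E.
Proof.
move=> uL; apply: ereal_sup_ubound => /=.
pose A (i : 'I_(size L)) : set (borel (rfiber (grng a))) :=
  group_slice (grng a) [set ((pt_group a : Gam) * nth 1%g L i)%g].
exists (size L), A; split.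
- by move=> i; exact: group_slice_measurable.
- move=> i j _ _ [u []]; rewrite /A /group_slice /= => -> /mulgI /eqP;
    rewrite nth_uniq// => /eqP ij.
  exact: val_inj.
- rewrite (big_nth 1%g) big_mkord -sumEFin; apply: eq_bigr => i _.
  rewrite group_massE /pushforward.
  rewrite (_ : @gtrans G a @^-1` A i = group_slice (gsrc a) [set nth 1%g L i]).
    by rewrite group_massE.
  apply/seteqP; split=> u; rewrite /A /group_slice /= /rfiber_val /gtrans /=
    pt_group_mul ?(set_valP u)//.
    by move/mulgI.
  by move=> ->.
Qed.

Hypothesis full : forall g, pdom c g = setT.
Hypothesis cZ : compact [set: Z].
Hypothesis mc : forall f : garr G -> R, continuous f ->
  compact (closure [set a | f a != 0]) ->
  continuous (fun x : gobj G => \int[m x]_b f (rfiber_val b)).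

(** This is an argument in the style of Dini. At each [z] the masses of an exhaustion increase to 1;
    the bound reached there persists at nearby points by continuity and at later stages by
    monotonicity, so compactness of [Z] gives one stage for all [z]. *)
Lemma group_mass_tight (e : R) : countable [set: Gam] -> 0 < e ->
  exists2 F : seq Gam, uniq F & forall z, 1 - e <= group_mass m z [set` F].
Proof.
move=> /countable_exhaustion[F [uF ndF exF]] e0.
suff [n _ nP] : \forall n \near \oo, [set:
  Z] `<=` [set z | 1 - e <= group_mass m z [set` F n]].
  by exists (F n) => // z; exact: (nP n (leqnn n) z).
have /compact_near_coveringP := cZ; apply => z _.
have lim1 : group_mass m z [set` F n] @[n --> \oo] --> (1 : R).
  have bigE : \bigcup_n @group_slice _ _ c z [set` F n] = setT.
    rewrite -subTset => u _; have [n nF] := exF (pt_group (rfiber_val u)).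
    by exists n.
  have := @nondecreasing_cvg_mu _ _ _ (m z) (fun n =>
    @group_slice _ _ c z [set` F n]).
  rewrite bigE => h; apply: fine_cvg.
  rewrite -(probability_setT (m z)); apply: h => //.
  - by move=> n; exact: group_slice_measurable.
  - by move=> i j ij; apply/subsetPset => u;
      exact: (subsetPset _ _ (ndF i j ij)).
have e2 : 1 - e < 1 by rewrite ltrBlDr ltrDl.
have /cvgr_gt/(_ _ e2)[n0 _ n0P] := lim1.
have cm := @group_mass_continuous _ _ _ _ _ full cZ mc [set` F n0] (finite_seq
  _) z.
exists ([set z' | 1 - e < group_mass m z' [set` F n0]], [set n | (n0 <= n)%N])
  => /=.
  split; last by exists n0.
  by move/cvgr_gt: cm; apply; apply: n0P => /=.
move=> [z' n] [/= h n0n]; apply: le_trans (ltW h) _.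
by apply: le_group_mass; exact: (subsetPset _ _ (ndF _ _ n0n)).
Qed.
End Tightness.

Lemma amenable_finite_means (R : realType) (Gam : groupType)
    (Z : topologicalType) (c : partial_action Gam Z) (S : seq Gam) (e : R) :
  countable [set: Gam] -> (forall g, pdom c g = setT) -> compact [set: Z] ->
  amenable R (partial_transformation_groupoid c) -> 0 < e ->
  exists (F : seq Gam) (zeta : Z -> Gam -> R),
  uniq F /\ [/\ forall g, continuous (zeta^~ g),
      forall z g, 0 <= zeta z g,
      forall z g, g \notin F -> zeta z g = 0,
      forall z, \sum_(g <- F) zeta z g = 1 &
      forall s z L, s \in S -> uniq L ->
        \sum_(g <- L) `|zeta z g - zeta (pact c s z) (s * g)%g| <= e].
Proof.
move=> cG full cZ /amenableP am e0.
(* The two truncations cost [2 * (e / 5)] each and the translation costs [e / 5]. *)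
have e50 : 0 < e / 5 by rewrite divr_gt0.
set G := partial_transformation_groupoid c in am.
have cK : compact [set a : garr G | [set` S] (pt_group a)].
  exact: group_slice_compact full cZ (finite_seq S).
have [m [mc mK]] := am _ _ cK e50.
have [F0 uF0 F0P] := group_mass_tight full cZ mc cG e50.
(* The identity is included because [trunc] stores the missing mass there. *)
pose F := undup (1%g :: F0).
have uF : uniq F by exact: undup_uniq.
have F1 : 1%g \in F by rewrite mem_undup mem_head.
pose xi z g := group_mass m z [set g].
have xi0 z g : 0 <= xi z g by exact: group_mass_ge0.
have xi1 z L : uniq L -> \sum_(g <- L) xi z g <= 1 by move=> uL;
  exact: (group_mass_le1 m z uL).
have xiF (z : Z) : 1 - e / 5 <= \sum_(g <- F) xi z g.
  rewrite -(group_mass_seq m z uF); apply: le_trans (F0P z) _;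
    apply: le_group_mass => g /= gF.
  by rewrite mem_undup inE gF orbT.
have xic g : continuous (fun z : Z => xi z g).
  exact: group_mass_continuous full cZ mc _ (finite_set1 g).
exists F, (fun z => trunc F (xi z)); split=> //; split.
- move=> g; rewrite /trunc; case: (g \in F); last by move=> z; exact: cvg_cst.
  move=> z; apply: cvgD; first exact: xic.
  apply: cvgM; first exact: cvg_cst.
  apply: cvgB; first exact: cvg_cst.
  by apply: (@continuous_sum _ Z _ F (fun h z => xi z h)) => h _; exact: xic.
- by move=> z g; exact: (trunc_ge0 uF (xi0 z) (@xi1 z)).
- by move=> z g /negbTE gF; rewrite /trunc gF.
- by move=> z; exact: (sum_trunc _ uF F1).
- move=> s z L sS uL.
  have ha : pt_set c (s, z) by rewrite /pt_set /= full.
  pose a : garr G := SigSub (mem_set ha).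
  have aK : [set` S] (pt_group a) by [].
  have := le_trans (group_mass_translate m a uL) (mK a aK);
    rewrite lee_fin => h1.
  have h2 := trunc_close uF (xi0 z) (@xi1 z) (xiF z) uL.
  have uL' : uniq [seq (s * g)%g | g <- L] by rewrite map_inj_uniq//;
    exact: mulgI.
  have h3 := trunc_close uF (xi0 (pact c s z)) (@xi1 (pact c s z)) (xiF (pact c
    s z)) uL'.
  rewrite big_map in h3.
  apply: le_trans (_ : \sum_(g <- L) (`|trunc F (xi z) g - xi z g| +
    `|xi z g - xi (pact c s z) (s * g)%g| +
    `|trunc F (xi (pact c s z)) (s * g)%g - xi (pact c s z) (s * g)%g|) <= _).
    apply: ler_sum => g _; rewrite [X in _ <= _ + X]distrC.
    by rewrite -addrA; apply: le_trans (ler_distD (xi z g) _ _) _;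
      rewrite lerD2l ler_distD.
  rewrite !big_split /=; apply: le_trans (lerD (lerD h2 h1) h3) _; lra.
Qed.

(** * Redistribution of the mass *)

Lemma sum_vanishing_subset (R : realType) (T : eqType) (F L : seq T) (f :
  T -> R) :
  uniq F -> uniq L -> {subset F <= L} -> (forall g, g \notin F -> f g = 0) ->
  \sum_(g <- F) f g = \sum_(g <- L) f g.
Proof.
move=> uF uL FL f0; rewrite [RHS](bigID (mem F))/= [X in _ + X]big1 ?addr0//.
rewrite -[RHS]big_filter; apply: perm_big; apply: uniq_perm => //.
  exact: filter_uniq.
by move=> g; rewrite mem_filter; case: (boolP (g \in F)) => //= /FL ->.
Qed.

Section Mean.
Variables (R : realType) (Gam : groupType) (F : seq Gam).
Implicit Types (chi zeta psi : Gam -> R).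

Definition window chi (g : Gam) : R := \sum_(h <- F) chi (g * h^-1)%g.

(** The integral of [psi] against the measure which moves the mass [zeta g] at [g]
    to the points [g h^-1], [h] in [F], proportionally to [chi].  If the window of
    [g] is empty, its inverse is [0]; this does not happen for [g] in [F]. *)
Definition mean zeta chi psi : R := \sum_(g <- F) \sum_(h <- F)
  zeta g * (chi (g * h^-1)%g / window chi g) * psi (g * h^-1)%g.

Lemma eq_mean zeta chi psi psi' :
  (forall k, chi k != 0 -> psi k = psi' k) ->
    mean zeta chi psi = mean zeta chi psi'.
Proof.
move=> E; apply: eq_bigr => g _; apply: eq_bigr => h _.
have [->|/E -> //] := eqVneq (chi (g * h^-1)%g) 0;
  by rewrite mul0r mulr0 !mul0r.
Qed.

Lemma mean_sum zeta chi (I : Type) (r : seq I) (u : I -> R) (psi : I ->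
  Gam -> R) :
  mean zeta chi (fun k => \sum_(i <- r) u i * psi i k) =
  \sum_(i <- r) u i * mean zeta chi (psi i).
Proof.
rewrite /mean [RHS](eq_bigr (fun i => \sum_(g <- F) \sum_(h <- F)
  u i * (zeta g * (chi (g * h^-1)%g / window chi g) * psi i (g * h^-1)%g)));
    last first.
  by move=> i _; rewrite mulr_sumr; apply: eq_bigr => g _; rewrite mulr_sumr.
rewrite [RHS]exchange_big; apply: eq_bigr => g _.
rewrite [RHS]exchange_big; apply: eq_bigr => h _.
by rewrite mulr_sumr; apply: eq_bigr => i _; rewrite mulrCA.
Qed.

(** This is the average of [psi] over the points to which the mass at [g] is moved, or 0 if the
    window is empty. It separates the dependence on [chi] from that on [zeta]. *)
Definition wmean chi psi (g : Gam) : R :=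
  (\sum_(h <- F) chi (g * h^-1)%g * psi (g * h^-1)%g) / window chi g.

Lemma meanE zeta chi psi : mean zeta chi psi =
  \sum_(g <- F) zeta g * wmean chi psi g.
Proof.
apply: eq_bigr => g _; rewrite /wmean mulr_suml mulr_sumr;
  apply: eq_bigr => h _.
by rewrite -!mulrA; congr (_ * (_ * _)); rewrite mulrC.
Qed.

Lemma window_ge1 chi g : (forall k, 0 <= chi k) -> chi 1%g = 1 -> g \in F ->
  1 <= window chi g.
Proof.
move=> chi0 chi1 gF; rewrite /window (big_rem g)//= mulgV chi1 lerDl.
by apply: sumr_ge0 => h _.
Qed.

Lemma wmean_le1 chi psi g : (forall k, 0 <= chi k) ->
  (forall k, `|psi k| <= 1) ->
  `|wmean chi psi g| <= 1.
Proof.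
move=> chi0 psi1; have D0 : 0 <= window chi g by apply: sumr_ge0 => h _.
rewrite /wmean normrM normfV (ger0_norm D0).
have [->|Dn0] := eqVneq (window chi g) 0; first by rewrite invr0 mulr0 ler01.
rewrite ler_pdivrMr ?mul1r; last by rewrite lt0r Dn0.
apply: le_trans (ler_norm_sum _ _ _) _; apply: ler_sum => h _.
by rewrite normrM (ger0_norm (chi0 _)) ler_piMr.
Qed.

Lemma mean1 zeta chi : (forall k, 0 <= chi k) -> chi 1%g = 1 ->
  \sum_(g <- F) zeta g = 1 -> mean zeta chi (fun=> 1) = 1.
Proof.
move=> chi0 chi1 z1; rewrite meanE -[RHS]z1; apply: eq_big_seq => g gF.
rewrite /wmean (eq_bigr (fun h => chi (g * h^-1)%g)); last by move=> h _;
  rewrite mulr1.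
by rewrite divff ?mulr1// gt_eqF// (lt_le_trans _ (window_ge1 chi0 chi1 gF)).
Qed.

(** Two quotients [a / D] and [B = a' / D'] are compared, whose numerators and denominators differ
    by at most [(size F)%:R * d]. The element [s * g] may lie outside [F], so [D'] may be 0; the
    estimate therefore divides by [D >= 1] only and uses [|B| <= 1]. *)
Lemma wmean_close chi chi' psi (s g : Gam) (d : R) :
  (forall k, 0 <= chi k) -> (forall k, 0 <= chi' k) -> chi 1%g = 1 ->
  (forall k, `|psi k| <= 1) -> (forall k, `|chi' (s * k)%g - chi k| <= d) ->
  g \in F ->
  `|wmean chi (fun k => psi (s * k)%g) g - wmean chi' psi (s * g)%g| <=
  2 * (size F)%:R * d.
Proof.
move=> chi0 chi0' chi1 psi1 close gF.
have D1 := window_ge1 chi0 chi1 gF.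
have D0 : 0 < window chi g by apply: lt_le_trans D1.
have b1 := wmean_le1 (s * g)%g chi0' psi1.
set B := wmean chi' psi (s * g)%g in b1 *.
set D := window chi g in D1 D0; set D' := window chi' (s * g)%g.
pose a := \sum_(h <- F) chi (g * h^-1)%g * psi (s * (g * h^-1))%g.
pose a' := \sum_(h <- F) chi' (s * (g * h^-1))%g * psi (s * (g * h^-1))%g.
have nd (f : Gam -> R) : (forall h, `|f h| <= d) ->
    `|\sum_(h <- F) f h| <= (size F)%:R * d.
  move=> fd; apply: le_trans (ler_norm_sum _ _ _) _.
  apply: (@le_trans _ _ (\sum_(h <- F) d)); first exact: ler_sum.
  by rewrite big_const_seq iter_addr addr0 count_predT mulr_natl.
have ha : `|a - a'| <= (size F)%:R * d.
  rewrite /a /a' -sumrB; apply: nd => h; rewrite -mulrBl normrM distrC.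
  by apply: le_trans (ler_piMr (normr_ge0 _) (psi1 _)) (close _).
have hD : `|D' - D| <= (size F)%:R * d.
  rewrite /D /D' /window -sumrB; apply: nd => h; rewrite -mulgA; exact: close.
have BE : B * D' = a'.
  rewrite /B /wmean -/D'.
  have -> : \sum_(h <- F) chi' (s * g * h^-1)%g * psi (s * g * h^-1)%g = a'.
    by apply: eq_bigr => h _; rewrite mulgA.
  (* For an empty window the identity survives because [|a'| <= D'] forces [a' = 0]. *)
  have [D'0|D'n0] := eqVneq D' 0; last by rewrite divfK.
  rewrite D'0 mulr0; apply/esym/eqP; rewrite -normr_le0.
  apply: le_trans (ler_norm_sum _ _ _) _; rewrite -[leRHS]D'0 /D' /window.
  apply: ler_sum => h _; rewrite normrM ger0_norm// mulgA; exact: ler_piMr.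
have -> : wmean chi (fun k => psi (s * k)%g) g - B = ((a - a') + B * (D' - D))
  / D.
  by rewrite /wmean -/D -/a mulrBr BE; field; rewrite gt_eqF.
rewrite normrM normfV (gtr0_norm D0) ler_pdivrMr//.
apply: le_trans (ler_normD _ _) _; rewrite normrM.
have d0 : 0 <= (size F)%:R * d by apply: le_trans hD.
apply: (@le_trans _ _ (2 * (size F)%:R * d * 1)); last first.
  by rewrite ler_wpM2l// -mulrA mulr_ge0.
rewrite mulr1 -mulrA mulr_natl mulr2n lerD//; apply: le_trans hD.
by rewrite ler_piMl.
Qed.

(** After reindexing the second mean by [s], each difference of terms splits as
    [(zeta - zeta') * B + zeta * (A - B)]. The first parts add up to at most [e], and [wmean_close]
    bounds the second ones. *)
Lemma mean_close zeta zeta' chi chi' psi (s : Gam) (e d : R) : uniq F ->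
  (forall k, 0 <= chi k) -> (forall k, 0 <= chi' k) -> chi 1%g = 1 ->
  (forall k, `|psi k| <= 1) -> (forall k, `|chi' (s * k)%g - chi k| <= d) ->
  (forall g, 0 <= zeta g) -> (forall g, 0 <= zeta' g) ->
  (forall g, g \notin F -> zeta g = 0) -> (forall g, g \notin F ->
    zeta' g = 0) ->
  \sum_(g <- F) zeta g = 1 ->
  (forall L, uniq L -> \sum_(g <- L) `|zeta g - zeta' (s * g)%g| <= e) ->
  `|mean zeta chi (fun k => psi (s * k)%g) - mean zeta' chi' psi| <=
  e + 2 * (size F)%:R * d.
Proof.
move=> uF chi0 chi0' chi1 psi1 close z0 z0' zF zF' z1 zz.
have d0 : 0 <= d by apply: le_trans (close 1%g).
(* Both [L] and its translate by [s] must contain [F], so that the two means become sums over the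
   same index list. *)
pose L := undup (F ++ [seq (s^-1 * g)%g | g <- F]).
have uL : uniq L by exact: undup_uniq.
have FL : {subset F <= L} by move=> g gF; rewrite mem_undup mem_cat gF.
rewrite !meanE (sum_vanishing_subset uF uL FL); last by move=> g /zF ->;
  rewrite mul0r.
pose sL := [seq (s * g)%g | g <- L].
have usL : uniq sL by rewrite map_inj_uniq//; exact: mulgI.
have FsL : {subset F <= sL}.
  move=> g gF; apply/mapP; exists (s^-1 * g)%g;
    last by rewrite mulgA mulgV mul1g.
  by rewrite mem_undup mem_cat map_f ?orbT.
rewrite [X in `|_ - X|](sum_vanishing_subset uF usL FsL);
  last by move=> g /zF' ->; rewrite mul0r.
rewrite big_map -sumrB; apply: le_trans (ler_norm_sum _ _ _) _.
set c := 2 * (size F)%:R * d; have c0 : 0 <= c by rewrite mulr_ge0// mulr_ge0.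
apply: (@le_trans _ _ (\sum_(g <- L) (`|zeta g - zeta' (s * g)%g| + zeta g *
  c))); last first.
  by rewrite big_split/= -mulr_suml -(sum_vanishing_subset uF uL FL zF) z1
    mul1r lerD2r zz.
apply: ler_sum => g _.
set A := wmean chi _ g; set B := wmean chi' psi _.
have B1 : `|B| <= 1 by exact: wmean_le1.
have -> : zeta g * A - zeta' (s * g)%g * B =
  (zeta g - zeta' (s * g)%g) * B + zeta g * (A - B) by ring.
apply: le_trans (ler_normD _ _) _; rewrite (normrM (zeta g - _)) (normrM (zeta
  g)) (ger0_norm (z0 g)).
apply: lerD; first exact: ler_piMr.
(* The comparison of the averages is available for [g] in [F] only; elsewhere [zeta g] is 0. *)
have [gF|/zF ->] := boolP (g \in F); last by rewrite !mul0r.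
by rewrite ler_wpM2l//; exact: wmean_close.
Qed.
End Mean.

(** * The groupoid of the product space *)

Lemma nbhs_setX (X Z : topologicalType) (x : X) (z : Z) A B :
  nbhs x A -> nbhs z B -> nbhs (x, z) (A `*` B).
Proof. by move=> xA zB; exists (A, B). Qed.

Lemma lc_space_prod (X Z : topologicalType) :
  lc_space X -> lc_space Z -> lc_space (X * Z)%type.
Proof.
move=> [hX lX [BX cBX [oBX bX]]] [hZ lZ [BZ cBZ [oBZ bZ]]].
have hXZ : hausdorff_space (X * Z)%type.
  move=> [x z] [x' z'] cl; congr pair.
  + apply: hX => A B xA x'B.
    have [[u v] [[/= uA _] [/= uB _]]] := cl (A `*` setT) (B `*` setT)
      (nbhs_setX xA filterT) (nbhs_setX x'B filterT).
    by exists u.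
  + apply: hZ => A B zA z'B.
    have [[u v] [[/= _ vA] [/= _ vB]]] := cl (setT `*` A) (setT `*` B)
      (nbhs_setX filterT zA) (nbhs_setX filterT z'B).
    by exists v.
split=> //.
- move=> [x z] _; have [U] := lX x I; have [V] := lZ z I.
  rewrite !withinET => zV [cV _] xU [cU _].
  exists (U `*` V); first by apply: filterS (nbhs_setX xU zV).
  have cUV := compact_setX cU cV.
  by split=> //; exact: compact_closed.
- exists [set AB.1 `*` AB.2 | AB in BX `*` BZ].
    apply: sub_countable (card_image_le _ _) _; exact: countableX.
  split=> [_ [[A B] [/= /oBX oA /oBZ oB] <-]|[x z] W [[A B] /= [xA zB] ABW]].
    rewrite openE => -[x z] [/= Ax Bz].
    by apply: nbhs_setX; exact: open_nbhs_nbhs.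
  have [A' [BA' A'x] A'A] := bX x A xA; have [B' [BB' B'z] B'B] := bZ z B zB.
  exists (A' `*` B').
    by split=> //; exists (A', B').
  by move=> [u v] [/= uA vB]; apply: ABW; split; [exact: A'A|exact: B'B].
Qed.

(** The measure is a convex combination of Dirac masses. Repeated points are allowed, since several
    pairs [(g, h)] can give the same [g * h^-1]. *)
Lemma atomic_probability d (T : measurableType d) (R : realType) (I : Type)
    (r : seq I) (w : I -> R) (p : I -> T) :
  (forall i, 0 <= w i) -> \sum_(i <- r) w i = 1 ->
  exists P : probability T R,
    (forall A, measurable A -> P A = (\sum_(i <- r) w i * \1_A (p i))%:E) /\
    (forall f : T -> R, measurable_fun setT f ->
      \int[P]_x f x = \sum_(i <- r) w i * f (p i)).
Proof.
case: r => [|i0 r0]; first by rewrite big_nil => _ /esym/eqP; rewrite oner_eq0.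
set r := i0 :: r0 => w0 w1.
pose wn n : {nonneg R} := NngNum (w0 (nth i0 r n)).
pose mu n : {measure set T -> \bar R} := mscale (wn n) (\d_(p (nth i0 r n))).
pose M := msum mu (size r).
have ME A : M A = (\sum_(i <- r) w i * \1_A (p i))%:E.
  rewrite /M /msum (big_nth i0) big_mkord -sumEFin; apply: eq_bigr => i _.
  by rewrite /= /mscale /= diracE.
have MT : M setT = 1%E.
  rewrite ME -w1; congr EFin; apply: eq_bigr => i _.
  by rewrite indicT mulr1.
pose P : probability T R := HB.pack_for (probability T R) M
  (Measure_isProbability.Build _ _ _ M MT).
exists P; split; first by move=> A _; exact: ME.
move=> f mf.
(* The integral is first computed for nonnegative functions, and then for the positive and negative
   parts of [f]. *)
have nonneg (g : T -> \bar R) : (forall x, 0 <= g x)%E ->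
  measurable_fun setT g ->
    (\int[M]_x g x = \sum_(i <- r) (w i)%:E * g (p i))%E.
  move=> g0 mg; rewrite ge0_integral_measure_sum// (big_nth i0) big_mkord.
  apply: eq_bigr => i _; rewrite ge0_integral_mscale//= integral_dirac//.
  by rewrite diracT mul1e.
have mE : measurable_fun setT (fun x => (f x)%:E) by exact/measurable_EFinP.
rewrite /Rintegral integralE !nonneg//; last 2 first.
- exact: measurable_funeneg.
- exact: measurable_funepos.
have posE i : ((fun x => (f x)%:E)^\+ (p i))%E = (Num.max (f (p i)) 0)%:E.
  by rewrite funeposE EFin_max.
have negE i : ((fun x => (f x)%:E)^\- (p i))%E = (Num.max (- f (p i)) 0)%:E.
  by rewrite funenegE EFin_max.
under eq_bigr do rewrite posE -EFinM.
under [X in (_ - X)%E]eq_bigr do rewrite negE -EFinM.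
rewrite !sumEFin -EFinB /= -sumrB; apply: eq_bigr => i _.
rewrite -mulrBr; congr (_ * _); have [h|h] := orP (le_total 0 (f (p i))).
  by rewrite (max_l h) max_r ?oppr_le0// subr0.
by rewrite (max_r h) max_l ?oppr_ge0// sub0r opprK.
Qed.

Section ProductSpace.
Variables (Gam : groupType) (X Z : topologicalType).
Variables (b : partial_action Gam X) (c : partial_action Gam Z).
Hypothesis full : forall g, pdom c g = setT.
Hypothesis hX : lc_space X.
Hypothesis hZ : lc_space Z.
Local Notation G := (partial_transformation_groupoid b).

(** On composable pairs [grng a] is the image of [y.1]. Written in this way, the map is continuous
    on all pairs and not only on the composable ones. *)
Definition prod_act (a : garr G) (y : X * Z) : X * Z :=
  (grng a, pact c (pt_group a) y.2).

Lemma prod_anchor_continuous : continuous (fst : X * Z -> gobj G).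
Proof. exact: fst_continuous. Qed.

Lemma pact_full_continuous :
  continuous (fun gz : discrete_topology Gam * Z => pact c gz.1 gz.2).
Proof.
move=> [g z] /= V nV.
have cg : {for z, continuous (pact c g)} by apply: pact_continuous_at;
  rewrite full.
exists ([set g], pact c g @^-1` V) => /=.
  by split; [exact: discrete_set1|exact: cg].
by move=> [g' z'] /= [-> ].
Qed.

Lemma prod_act_continuous : {within [set ay | gsrc ay.1 = fst ay.2],
  continuous (fun ay : garr G * (X * Z) => prod_act ay.1 ay.2)}.
Proof.
apply: continuous_subspaceT.
have c1 := @fst_continuous (garr G) (X * Z)%type.
have c2 := @snd_continuous (garr G) (X * Z)%type.
apply: pair_continuous; first exact: comp_continuous c1 (@grng_continuous G).
apply: (comp_continuous (f := fun ay : garr G * (X * Z) =>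
  (pt_group ay.1, ay.2.2)) _ pact_full_continuous).
apply: pair_continuous.
  exact: comp_continuous c1 (@pt_group_continuous _ _ b).
exact: comp_continuous c2 (@snd_continuous _ _).
Qed.

Lemma prod_anchor_act (a : garr G) (y : X * Z) :
  gsrc a = y.1 -> (prod_act a y).1 = grng a.
Proof. by []. Qed.

Lemma prod_act_unit (y : X * Z) : prod_act (@gunit G y.1) y = y.
Proof. by rewrite /prod_act grng_unit /pt_group /= pact1; case: y. Qed.

Lemma prod_act_mul (a a' : garr G) (y : X * Z) : gsrc a = grng a' ->
  gsrc a' = y.1 -> prod_act (gmul a a') y = prod_act a (prod_act a' y).
Proof.
move=> aa' _; rewrite /prod_act grng_mul// pt_group_mul//=; congr pair.
by have [] := @pact_mul _ _ c (pt_group a) (pt_group a') y.2;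
  rewrite full.
Qed.

Definition prod_gspace : gspace G := @GSpace G (X * Z)%type
  (lc_space_prod hX hZ) fst prod_act prod_anchor_continuous
  prod_act_continuous prod_anchor_act prod_act_unit prod_act_mul.

Local Notation H := (semidirect prod_gspace).
Local Notation Gof a := ((set_val a).2 : garr G).

Definition sd_group (a : garr H) : discrete_topology Gam := pt_group (Gof a).

Lemma sd_group_continuous : continuous sd_group.
Proof.
apply: comp_continuous (@pt_group_continuous _ _ b).
exact: comp_continuous (@set_val_continuous _ _) (@snd_continuous _ _).
Qed.

Lemma sd_rng1 (a : garr H) : (grng a).1 = grng (Gof a).
Proof. exact: (set_valP a). Qed.

Lemma sd_src1 (a : garr H) : (gsrc a).1 = gsrc (Gof a).
Proof. exact: (@grng_inv G (Gof a)). Qed.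

Lemma sd_src_dom (a : garr H) : pdom b (sd_group a : Gam)^-1%g (gsrc a).1.
Proof. by rewrite sd_src1; exact: pt_group_dom. Qed.

(** In these coordinates the semidirect product is the groupoid of the diagonal partial action on
    [X * Z]. *)
Lemma sd_rng_pact (a : garr H) :
  grng a = (pact b (sd_group a) (gsrc a).1, pact c (sd_group a) (gsrc a).2).
Proof.
rewrite [LHS]surjective_pairing; congr pair.
  by rewrite sd_rng1 sd_src1 pt_group_rng.
by rewrite /= pactVK// full.
Qed.

Lemma sd_group_mul (a a' : garr H) : gsrc a = grng a' ->
  sd_group (gmul a a') = ((sd_group a : Gam) * sd_group a')%g.
Proof.
move=> aa'.
have sr : gsrc (Gof a) = grng (Gof a') by rewrite -sd_src1 aa' sd_rng1.
have -> : sd_group (gmul a a') = pt_group (gmul (Gof a) (Gof a')).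
  have E : set_val (sd_mul a a') = ((set_val a).1, gmul (Gof a) (Gof a')).
    rewrite set_valE /sd_mul insubdK//.
    apply/mem_set; rewrite /sd_set /=; apply: etrans (esym (grng_mul sr)).
    exact: sd_rng1.
  by rewrite /sd_group -[gmul a a']/(sd_mul a a') E.
exact: pt_group_mul.
Qed.

Lemma sd_rfiber_inj (y : gobj H) (u v : rfiber y) :
  sd_group (rfiber_val u) = sd_group (rfiber_val v) -> u = v.
Proof.
move=> guv; apply: val_inj; rewrite -set_valE; apply: val_inj;
  rewrite -set_valE.
have ru : grng (rfiber_val u) = y := set_valP u.
have rv : grng (rfiber_val v) = y := set_valP v.
rewrite [LHS]surjective_pairing [RHS]surjective_pairing; congr pair.
  exact: etrans ru (esym rv).
apply: pt_arr_eq => //; apply: etrans (esym (sd_rng1 (rfiber_val u))) _.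
by apply: etrans (sd_rng1 (rfiber_val v)); rewrite ru rv.
Qed.

(** The junk value at [k] with [y.1] outside [pdom b k] is the unit; the function
    [chi] vanishes there. *)
Definition fiber_pt (y : gobj H) (k : Gam) : rfiber y :=
  xget point [set u | sd_group (rfiber_val u) = k].

Lemma fiber_ptE (y : gobj H) (u : rfiber y) :
  fiber_pt y (sd_group (rfiber_val u)) = u.
Proof.
rewrite /fiber_pt; case: xgetP => [v _ /sd_rfiber_inj //|].
by move/(_ u) => /=.
Qed.

Section Chart.
Variable k : Gam.
Let U : set (X * Z) := [set y | pdom b k y.1].

Lemma chart_pt_subproof (y : X * Z) : U y -> pt_set b (k, pact b k^-1%g y.1).
Proof. by move=> ky; rewrite /pt_set /=; apply: pact_dom; rewrite invgK. Qed.

Lemma chart_rng_subproof (y : X * Z) (Uy : U y) :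
  @sd_set G prod_gspace (y, SigSub (mem_set (chart_pt_subproof Uy))).
Proof. by rewrite /sd_set /= /pt_rng /= pactVK. Qed.

(** Where [k] occurs in the fiber, [fiber_pt] is given by this explicit formula, whose continuity in
    the base point is visible, unlike that of a chosen element. *)
Definition chart (w : set_type U) : garr H :=
  SigSub (mem_set (chart_rng_subproof (set_valP w))).

Lemma chart_continuous : continuous chart.
Proof.
apply: (set_type_continuous (f := chart)).
apply: pair_continuous; first exact: set_val_continuous.
apply: set_type_continuous.
apply: (pair_continuous (U := discrete_topology Gam)).
  exact: (@cst_continuous _ (discrete_topology Gam) (k :
    discrete_topology Gam)).
move=> w; apply: (continuous_comp (f := fun w : set_type U => (set_val w).1)).
  exact: (comp_continuous (@set_val_continuous _ _) (@fst_continuous _ _)).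
by apply: pact_continuous_at; rewrite invgK; exact: (set_valP w).
Qed.

Lemma fiber_pt_chart (w : set_type U) : rfiber_val (fiber_pt (set_val w) k) =
  chart w.
Proof.
have rw : [set a : garr H | grng a = set_val w] (chart w) by [].
pose u : @rfiber H (set_val w) := SigSub (mem_set rw).
by rewrite -[chart w]/(rfiber_val u) -(fiber_ptE u).
Qed.

Lemma fiber_pt_continuous (S : topologicalType) (f : garr H -> S) y :
  continuous f -> pdom b k y.1 ->
  {for y, continuous (fun y : X * Z => f (rfiber_val (fiber_pt y k)))}.
Proof.
move=> cf ky.
have oU : open U.
  by move/continuousP: (@fst_continuous X Z); apply; exact: pdom_open.
have : {within U, continuous (fun y : X * Z => f (rfiber_val (fiber_pt y k)))}.
  apply/subspace_sigL_continuousP.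
  rewrite (_ : sigL _ _ = fun w => f (chart w)).
    exact: comp_continuous chart_continuous cf.
  by apply/funext => w; rewrite /sigL /= fiber_pt_chart.
by rewrite continuous_open_subspace//; apply; exact/mem_set.
Qed.
End Chart.

(** Translation multiplies the group coordinate on the left, and this coordinate determines a point
    of the fiber. The domain condition ensures that the point at [k] is not the default one. *)
Lemma gtrans_fiber_pt (a : garr H) (k : Gam) : pdom b k (gsrc a).1 ->
  gtrans (fiber_pt (gsrc a) k) = fiber_pt (grng a) ((sd_group a : Gam) * k)%g.
Proof.
move=> ka.
pose U := [set y : X * Z | pdom b k y.1]; have Ua : U (gsrc a) by [].
pose w : set_type U := SigSub (mem_set Ua).
have gk : sd_group (rfiber_val (fiber_pt (gsrc a) k)) = k.
  by rewrite -[gsrc a]/(set_val w) fiber_pt_chart.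
rewrite -[LHS]fiber_ptE; congr fiber_pt.
rewrite {1}/rfiber_val /gtrans /= sd_group_mul ?gk//.
exact/esym/(set_valP (fiber_pt (gsrc a) k)).
Qed.

Lemma sd_rfiber_measurable (y : gobj H) (A : set (borel (rfiber y))) :
  measurable A.
Proof.
by apply: rfiber_measurable sd_group_continuous _; exact: sd_rfiber_inj.
Qed.
End ProductSpace.

Lemma compact_discrete_image (T : topologicalType) (D : choiceType)
    (p : T -> discrete_topology D) (K : set T) :
  countable [set: D] -> continuous p -> compact K ->
  exists S : seq D, forall a, K a -> p a \in S.
Proof.
move=> /countable_exhaustion[F [_ ndF exF]] cp /compact_near_coveringP cK.
suff [n _ nP] : \forall n \near \oo, K `<=` [set a | p a \in F n].
  by exists (F n) => a; exact: (nP n (leqnn n)).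
apply: cK => a _; have [n0 an0] := exF (p a).
exists ([set a' | p a' = p a], [set n | (n0 <= n)%N]) => /=.
  by split; [exact: cp (discrete_set1 (p a))|exists n0].
move=> [a' n] [/= -> n0n]; exact: (subsetPset _ _ (ndF _ _ n0n)) an0.
Qed.

Lemma compact_support_bounded (R : realType) (T : topologicalType) (f : T ->
  R) :
  continuous f -> compact (closure [set a | f a != 0]) ->
  exists M, forall a, `|f a| <= M.
Proof.
move=> cf cs; have := continuous_compact (continuous_subspaceT cf) cs.
move=> /compact_bounded[M [_ /(_ (`|M| + 1))]] MP.
exists (`|M| + 1) => a; have [->|fa] := eqVneq (f a) 0.
  by rewrite normr0 addr_ge0.
apply: MP; first by rewrite (le_lt_trans (ler_norm M))// ltrDl.
by exists a => //; exact: subset_closure.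
Qed.

(** * Amenability of the product groupoid *)

Section ProductAmenable.
Variables (R : realType) (Gam : groupType) (X Z : topologicalType).
Variables (b : partial_action Gam X) (c : partial_action Gam Z).
Hypothesis full : forall g, pdom c g = setT.
Hypothesis hX : lc_space X.
Hypothesis hZ : lc_space Z.
Local Notation H := (semidirect (prod_gspace b full hX hZ)).

Lemma compact_cutoff (K : set (garr H)) (S : seq Gam) (N : nat) :
  compact K -> (forall a, K a -> sd_group a \in S) ->
  exists chi : X -> Gam -> R,
  [/\ forall k, continuous (chi^~ k), forall x k, 0 <= chi x k <= 1,
      forall x k, ~ pdom b k x -> chi x k = 0, forall x, chi x 1%g = 1 &
      forall a k, K a -> `|chi (grng a).1 ((sd_group a : Gam) * k)%g -
        chi (gsrc a).1 k| <= N.+1%:R^-1].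
Proof.
move=> cK KS.
have c1 : continuous (fun a : garr H => (grng a).1).
  exact: comp_continuous (@grng_continuous H) (@fst_continuous _ _).
have c2 : continuous (fun a : garr H => (gsrc a).1).
  exact: comp_continuous (@gsrc_continuous H) (@fst_continuous _ _).
have cKt (t : Gam) : compact (K `&` [set a : garr H | sd_group a = t]).
  apply: compact_closedI => //.
  have /continuous_closedP := @sd_group_continuous _ _ _ b c full hX hZ.
  by move=> /(_ [set t]); apply; exact: discrete_closed.
(* These are the points where a step [t] must have full weight: the ranges of the arrows of [K] with
   coordinate [t], and the sources of those with coordinate [t^-1], which are traversed
   backwards. *)
pose C (t : Gam) : set X :=
  (fun a => (grng a).1) @` (K `&` [set a : garr H | sd_group a = t]) `|`
  (fun a => (gsrc a).1) @` (K `&` [set a : garr H | sd_group a = t^-1%g]).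
have cC t : compact (C t).
  by apply: compactU; apply: continuous_compact => //;
    exact: continuous_subspaceT.
have Ct t : C t `<=` pdom b t.
  move=> _ [[a [Ka <-] <-]|[a [Ka ga] <-]].
    by rewrite sd_rng_pact /=; apply: pact_dom; exact: sd_src_dom.
  by have := sd_src_dom a; rewrite ga invgK.
have /choice[kap kapP] : forall t, exists f : X -> R, [/\ continuous f,
    forall x, 0 <= f x <= 1, forall x, C t x -> f x = 1 &
    forall x, ~ pdom b t x -> f x = 0].
  by move=> t; apply: lc_compact_separation => //; exact: pdom_open.
have kc t : continuous (kap t) by have [] := kapP t.
have k01 t x : 0 <= kap t x <= 1 by have [] := kapP t.
have kC t x : C t x -> kap t x = 1 by have [_ _ + _] := kapP t; apply.
have k0 t x : ~ pdom b t x -> kap t x = 0 by have [_ _ _] := kapP t; apply.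
pose T := S ++ [seq s^-1%g | s <- S].
exists (fun x k => cutoff b T kap N k x); split.
- by move=> k; exact: cutoff_continuous.
- by move=> x k; exact: cutoff01.
- by move=> x k; exact: cutoff_dom.
- by move=> x; exact: cutoff1.
move=> a k Ka; set s : Gam := sd_group a.
have sS : s \in S by exact: KS.
have dom := sd_src_dom a.
(* The two inequalities come from the step [s] at the range of [a] and the step [s^-1] at its
   source; this is why [T] also contains the inverses. *)
have h1 : cutoff b T kap N k (gsrc a).1 <=
    cutoff b T kap N (s * k)%g (grng a).1 + N.+1%:R^-1.
  have sT : s \in T by rewrite mem_cat sS.
  have ks : kap s (grng a).1 = 1 by apply: kC; left; exists a.
  have := cutoff_step b k01 N (s * k)%g sT ks.
  by rewrite mulgA mulVg mul1g sd_rng_pact /= pactK.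
have h2 : cutoff b T kap N (s * k)%g (grng a).1 <=
    cutoff b T kap N k (gsrc a).1 + N.+1%:R^-1.
  have sT : s^-1%g \in T by rewrite mem_cat map_f ?orbT.
  have ks : kap s^-1%g (gsrc a).1 = 1.
    by apply: kC; right; exists a => //; split=> //=; rewrite invgK.
  by have := cutoff_step b k01 N k sT ks; rewrite invgK sd_rng_pact.
by rewrite ler_distl lerBlDr h1 h2.
Qed.

Lemma prod_semidirect_amenable : countable [set: Gam] ->
  compact [set: Z] -> amenable R (partial_transformation_groupoid c) ->
  amenable R H.
Proof.
move=> cG cZ am; apply/amenableP => K e cK e0.
have [S KS] := compact_discrete_image cG (@sd_group_continuous _ _ _ b c full
  hX hZ) cK.
have e20 : 0 < e / 2 by rewrite divr_gt0.
have [F [zeta [uF [zc z0 zF z1 zS]]]] := amenable_finite_means S cG full cZ am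
  e20.
(* The set [F] depends on [S] and [e] only, so [N] can be adapted to its size before [chi] is
   constructed. *)
pose N := Num.truncn ((e / 2)^-1 * (2 * (size F)%:R)).
have NP : 2 * (size F)%:R * N.+1%:R^-1 <= e / 2.
  by rewrite ler_pdivrMr// -ler_pdivrMl// ltW// truncnS_gt.
have [chi [chic chi01 chidom chi1 chiK]] := compact_cutoff N cK KS.
have chi0 x k : 0 <= chi x k by have /andP[] := chi01 x k.
have win1 x g : g \in F -> 1 <= window F (chi x) g by apply: window_ge1.
pose w (y : X * Z) (gh : Gam * Gam) : R :=
  zeta y.2 gh.1 * (chi y.1 (gh.1 * gh.2^-1)%g / window F (chi y.1) gh.1).
pose r := [seq (g, h) | g <- F, h <- F].
have w0 y gh : 0 <= w y gh by rewrite !mulr_ge0// invr_ge0 sumr_ge0.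
have wE y psi : \sum_(gh <- r) w y gh * psi (gh.1 * gh.2^-1)%g =
    mean F (zeta y.2) (chi y.1) psi by rewrite big_allpairs.
have w1 y : \sum_(gh <- r) w y gh = 1.
  rewrite -[RHS](mean1 (chi0 y.1) (chi1 y.1) (z1 y.2)) -wE.
  by apply: eq_bigr => gh _; rewrite mulr1.
have exP : forall y : gobj H, exists P : probability (borel (rfiber y)) R,
    (forall A, measurable A -> P A = (mean F (zeta y.2) (chi y.1)
       (fun k => \1_A (fiber_pt y k)))%:E) /\
    (forall f : borel (rfiber y) -> R, measurable_fun setT f ->
      \int[P]_x f x = mean F (zeta y.2) (chi y.1) (fun k => f (fiber_pt y k))).
  move=> y; have [P [PA Pf]] := atomic_probability
    (fun gh => fiber_pt y (gh.1 * gh.2^-1)%g : borel (rfiber y)) (w0 y) (w1 y).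
  by exists P; split=> [A mA|f mf]; rewrite -wE; [exact: PA|exact: Pf].
pose m y := projT1 (cid (exP y)).
have mP y :
    (forall A, measurable A -> m y A = (mean F (zeta y.2) (chi y.1)
       (fun k => \1_A (fiber_pt y k)))%:E) /\
    (forall f : borel (rfiber y) -> R, measurable_fun setT f ->
      \int[m y]_x f x = mean F (zeta y.2) (chi y.1) (fun k =>
        f (fiber_pt y k))).
  exact: projT2 (cid (exP y)).
exists m; split.
  move=> f cf csf.
  have [M fM] := compact_support_bounded cf csf.
  (* The factors are regrouped so that [chi] stands next to the value of [f]: the latter is
     continuous on the domain only, the product everywhere. *)
  rewrite (_ : (fun x => _) = fun y : X * Z => \sum_(g <- F) \sum_(h <- F)
    zeta y.2 g * (window F (chi y.1) g)^-1 * (chi y.1 (g * h^-1)%g *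
      f (rfiber_val (fiber_pt (y : gobj H) (g * h^-1)%g)))); last first.
    apply/funext => y; rewrite (mP y).2; last first.
      by move=> _ A _; exact: sd_rfiber_measurable.
    apply: eq_bigr => g _; apply: eq_bigr => h _.
    by rewrite -!mulrA; congr (_ * _); rewrite mulrCA.
  apply: (@continuous_sum _ (X * Z)%type) => g gF.
  apply: (@continuous_sum _ (X * Z)%type) => h _.
  have c1 : continuous (fun y : X * Z => zeta y.2 g).
    exact: comp_continuous (@snd_continuous _ _) (zc g).
  have c2 : continuous (fun y : X * Z => (window F (chi y.1) g)^-1).
    move=> y; apply: cvgV; first by rewrite gt_eqF// (lt_le_trans ltr01)// win1.
    apply: (@continuous_sum _ (X * Z)%type _ F
      (fun h' y => chi y.1 (g * h'^-1)%g)) => h' _.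
    exact: comp_continuous (@fst_continuous _ _) (chic _).
  have c3 : continuous (fun y : X * Z => chi y.1 (g * h^-1)%g *
      f (rfiber_val (fiber_pt (y : gobj H) (g * h^-1)%g))).
    apply: (@continuous_vanishing_mul R (X * Z)%type
      [set y | pdom b (g * h^-1)%g y.1] (fun y => chi y.1 (g * h^-1)%g)
      (fun y => f (rfiber_val (fiber_pt (y : gobj H) (g * h^-1)%g))) M).
    - by move=> ?; exact: fM.
    - by move=> ? ?; exact: fiber_pt_continuous.
    - exact: comp_continuous (@fst_continuous _ _) (chic _).
    - by move=> ? ?; exact: chidom.
  by move=> y; exact: cvgM (cvgM (c1 y) (c2 y)) (c3 y).
move=> a Ka; set s : Gam := sd_group a.
apply: ge_ereal_sup => _ [n [A [mA tA ->]]].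
set y := gsrc a; set y' := grng a.
pose phi i k : R := \1_(A i) (fiber_pt y' k).
pose D i := mean F (zeta y.2) (chi y.1) (fun k => phi i (s * k)%g) -
  mean F (zeta y'.2) (chi y'.1) (phi i).
rewrite (eq_bigr (fun i => `|D i|%:E)); last first.
  move=> i _; rewrite /pushforward (mP y).1; last exact: sd_rfiber_measurable.
  rewrite (mP y').1; last exact: sd_rfiber_measurable.
  (* Only those [k] with nonzero [chi] contribute; they lie in the domain, where the translation
     formula for [fiber_pt] holds. *)
  rewrite -EFinB abse_EFin; congr (`|_ - _|%:E); apply: eq_mean => k chik.
  have ka : pdom b k y.1.
    by apply: contrapT => /chidom h; rewrite h eqxx in chik.
  by rewrite /phi -gtrans_fiber_pt.
rewrite sumEFin lee_fin.
(* Choosing the signs turns the sum of absolute values into a difference of means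
   of one function bounded by 1, the sets [A i] being disjoint. *)
pose psi k : R := \sum_(i < n) Num.sg (D i) * phi i k.
have psi1 k : `|psi k| <= 1.
  rewrite /psi; have [[i Ai]|nA] := pselect (exists i, A i (fiber_pt y' k)).
    rewrite (bigD1 i)//= big1 ?addr0 => [|j ji].
      rewrite normrM normr_sg /phi indicE mem_set// normr1 mulr1.
      by case: (_ != 0).
    rewrite /phi indicE memNset ?mulr0// => Aj; move/eqP: ji; apply.
    by apply: tA => //; exists (fiber_pt y' k).
  rewrite big1 ?normr0// => i _; rewrite /phi indicE memNset ?mulr0// => Ai.
  by apply: nA; exists i.
have -> : \sum_(i < n) `|D i| = mean F (zeta y.2) (chi y.1) (fun k =>
  psi (s * k)%g) -
    mean F (zeta y'.2) (chi y'.1) psi.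
  rewrite /psi !mean_sum -sumrB; apply: eq_bigr => i _.
  by rewrite -mulrBr normrEsg.
apply: le_trans (ler_norm _) _.
apply: (@le_trans _ _ (e / 2 + 2 * (size F)%:R * N.+1%:R^-1)); last first.
  by rewrite [leRHS]splitr lerD2l.
apply: (mean_close uF (chi0 _) (chi0 _) (chi1 _) psi1
  (fun k => chiK a k Ka) (z0 _) (z0 _) (zF _) (zF _) (z1 _)).
move=> L uL; have -> : y'.2 = pact c s y.2 by rewrite /y' sd_rng_pact.
by apply: zS => //; exact: KS.
Qed.
End ProductAmenable.

Theorem proposition6p12 (R : realType) (Gam : groupType) (X : topologicalType)
    (b : partial_action Gam X) :
  countable [set: Gam] -> exact_group R Gam -> lc_space X ->
  strongly_amenable_at_infinity R (partial_transformation_groupoid b).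
Proof.
move=> cG [Z [c [hZ cZ [z0 _] full am]]] hX.
(* Compactness of [Z] makes the projection proper, and the point [z0] gives surjectivity and the
   constant section. *)
exists (prod_gspace b full hX hZ); split.
- move=> K cK; rewrite (_ : _ @^-1` _ = K `*` setT); first exact: compact_setX.
  by apply/seteqP; split=> y //= [].
- by move=> x; exists (x, z0).
- exists (fun x => (x, z0)) => //.
  by apply: pair_continuous => x; [exact: cvg_id|exact: cvg_cst].
- exact: prod_semidirect_amenable.
Qed.
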